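(* Let $X$ be a Banach space, let $f\colon X\to\overline{\mathbb{R}}:=(-\infty,\infty]$ be lower semicontinuous around $\bar x\in\mathrm{dom}\, f$, let $\bar x^*\in\partial f(\bar x)$, and let $q>0$ be an arbitrary positive number. Consider the following two statements: **(i)** The set-valued mapping $\partial f\colon X\rightrightarrows X^*$ is metrically $q$-subregular at $(\bar x,\bar x^* )$ with modulus $\tilde\kappa>0$, and there exist numbers $\gamma>0$ and $r\in(0,q/\kappa)$, where $\kappa:=q\,\tilde\kappa^{1/q}$, such that $$f(x)\ge f(\bar x)+\langle\bar x^*,x-\bar x\rangle-\frac{qr}{1+q}\,\Big[d\big(x;(\partial f)^{-1}(\bar x^* )\big)\Big]^{\frac{1+q}{q}}\quad\text{for all } x\in \mathbb{B}(\bar x,\gamma).$$ **(ii)** There are two positive numbers $\alpha$ and $\eta$ such that $$f(x)\ge f(\bar x)+\langle\bar x^*,x-\bar x\rangle+\frac{q\alpha}{1+q}\,\Big[d\big(x;(\partial f)^{-1}(\bar x^* )\big)\Big]^{\frac{1+q}{q}}\quad\text{for all } x\in \mathbb{B}(\bar x,\eta).$$ Then: (a) (ii) implies (i) provided that, for the numbers $\alpha,\eta$ from (ii), there is $\beta\in(0,\alpha)$ such that $$f(u)\ge f(x)+\langle x^*,u-x\rangle-\frac{q\beta}{1+q}\,\Big[d\big(x;(\partial f)^{-1}(\bar x^* )\big)\Big]^{\frac{1+q}{q}}$$ whenever $(u,\bar x^* )$ and $(x,x^* )$ both belong to $(\mathrm{gph}\,\partial f)\cap\mathbb{B}\Big((\bar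 x,\bar x^* ),\,\eta+\big(\tfrac{q\eta}{1+q}\big)^{1/q}\Big)$. (b) Conversely, if the space $X$ is Asplund, then (i) implies that (ii) holds for any fixed $\alpha\in(0,q/\kappa)$; that is, for every $\alpha\in(0,q/\kappa)$ there is $\eta>0$ such that the inequality in (ii) holds for all $x\in\mathbb{B}(\bar x,\eta)$.
   Context: Notation: $X^*$ is the topological dual of $X$; $\mathbb{B}(x,r)$ is the closed ball centered at $x$ with radius $r>0$ in the space in question; the product $X\times X^*$ carries the sum norm $\|(x,x^* )\|=\|x\|+\|x^*\|$. $\mathrm{dom}\,f=\{x: f(x)<\infty\}$. $d(x;\Omega)=\inf_{w\in\Omega}\|x-w\|$ is the distance function, with $d(x;\emptyset)=\infty$. For a set-valued mapping $F\colon X\rightrightarrows Y$, $\mathrm{gph}\,F=\{(x,y): y\in F(x)\}$ and $F^{-1}(y)=\{x: y\in F(x)\}$. A Banach space is Asplund if each of its separable subspaces has a separable dual. Subdifferentials: for $\varphi\colon X\to\overline{\mathbb{R}}$ and $x_0\in\mathrm{dom}\,\varphi$, the regular subdifferential is $$\widehat\partial\varphi(x_0):=\Big\{v\in X^*\ \Big|\ \liminf_{x\to x_0}\frac{\varphi(x)-\varphi(x_0)-\langle v,x-x_0\rangle}{\|x-x_0\|}\ge0\Big\},$$ and the (basic, limiting) subdifferential $\partial\varphi(x_0)$ is the set of all $x^*\in X^*$ for which there exist sequences $x_k\to x_0$ with $\varphi(x_k)\to\varphi(x_0)$ and $x_k^*\in\widehat\partial\varphi(x_k)$ ($k\in\mathbb{N}$)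 such that $x_k^*\to x^*$ in the weak$^*$ topology. Both sets are taken to be empty at points outside $\mathrm{dom}\,\varphi$. Metric $q$-subregularity: for $q>0$, a set-valued mapping $F\colon X\rightrightarrows Y$ between Banach spaces with $(\bar x,\bar y)\in\mathrm{gph}\,F$ is metrically $q$-subregular at $(\bar x,\bar y)$ with modulus $\eta>0$ if there is $\gamma>0$ such that $$d\big(x;F^{-1}(\bar y)\big)\le\eta\,\big[d\big(\bar y;F(x)\big)\big]^q\quad\text{for all }x\in\mathbb{B}(\bar x,\gamma).$$ *)

(* Defs.v *)
From HB Require Import structures.
From mathcomp Require Import all_boot all_order all_algebra.
From mathcomp Require Import all_classical all_reals all_analysis.

Set Implicit Arguments.
Unset Strict Implicit.
Unset Printing Implicit Defensive.

Import Order.TTheory GRing.Theory Num.Theory.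
Import numFieldNormedType.Exports.

Local Open Scope classical_set_scope.
Local Open Scope ring_scope.

Section Dual.
Context {R : realType} (X : normedModType R).

Definition dual_pred : {pred X -> R^o} :=
  [pred f : X -> R^o | `[< linear f /\ continuous f >]].

Record dual := Dual { dual_fun :> X -> R^o ; _ : dual_fun \in dual_pred }.

HB.instance Definition _ := [isSub for dual_fun].
HB.instance Definition _ := [Choice of dual by <:].

Lemma dual_linear (f : dual) : linear f.
Proof. by case: f => f /= /asboolP[]. Qed.

Lemma dual_continuous (f : dual) : continuous f.
Proof. by case: f => f /= /asboolP[]. Qed.

Lemma dual_submod_closed : submod_closed dual_pred.
Proof.
split=> [|a f g]; rewrite !inE.
  split=> [b x y|x].
    by change (0 = b *: 0 + 0 :> R^o); rewrite scaler0 addr0.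
  exact: (@cst_continuous X R^o 0).
move=> [lf cf] [lg cg]; split=> [b x y|x].
  change (a *: f (b *: x + y) + g (b *: x + y) =
    b *: (a *: f x + g x) + (a *: f y + g y)).
  by rewrite lf lg !scalerDr !scalerA (mulrC b a) addrACA.
by apply: cvgD; [apply: cvgZr; exact: cf|exact: cg].
Qed.

HB.instance Definition _ :=
  GRing.isSubmodClosed.Build R (X -> R^o) dual_pred dual_submod_closed.
HB.instance Definition _ := [SubChoice_isSubLmodule of dual by <:].

HB.instance Definition _ (f : dual) :=
  GRing.isLinear.Build R X R^o _ (dual_fun f) (dual_linear f).

Definition dual_norm (f : dual) : R :=
  sup [set `|f x| | x in [set x : X | `|x| <= 1]].

Let has_sup_dual (f : dual) :
  has_sup [set `|f x| | x in [set x : X | `|x| <= 1]].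
Proof.
split; first by exists `|f 0|, 0 => //=; rewrite normr0.
have /linear_bounded_continuous/bounded_funP/(_ 1)[M fM] := @dual_continuous f.
by exists M => _ [x x1 <-]; exact: fM.
Qed.

Lemma dual_norm_ub (f : dual) x : `|f x| <= dual_norm f * `|x|.
Proof.
have [->|x0] := eqVneq x 0; first by rewrite linear0 !normr0 mulr0.
have nx0 : 0 < `|x| by rewrite normr_gt0.
rewrite -ler_pdivrMr//; apply: ub_le_sup; first exact: (has_sup_dual f).2.
exists (`|x|^-1 *: x) => /=.
  by rewrite normrZ normfV normr_id mulVf ?gt_eqF.
by rewrite linearZ/= normrZ normfV normr_id mulrC.
Qed.

Let dual_norm_le (f : dual) M :
  (forall x, `|x| <= 1 -> `|f x| <= M) -> dual_norm f <= M.
Proof.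
move=> fM; apply: ge_sup; first exact: (has_sup_dual f).1.
by move=> _ [x x1 <-]; exact: fM.
Qed.

Let dual_norm_ub1 (f : dual) x : `|x| <= 1 -> `|f x| <= dual_norm f.
Proof.
by move=> x1; apply: ub_le_sup; [exact: (has_sup_dual f).2|exists x].
Qed.

Let dual_normD f g : dual_norm (f + g) <= dual_norm f + dual_norm g.
Proof.
apply: dual_norm_le => x x1; apply: (le_trans (ler_normD _ _)).
by apply: lerD; exact: dual_norm_ub1.
Qed.

Let dual_norm_ge0 f : 0 <= dual_norm f.
Proof. by apply: le_trans (@dual_norm_ub1 f 0 _); rewrite ?normr0. Qed.

Let dual_normZ_le (a : R) f : dual_norm (a *: f) <= `|a| * dual_norm f.
Proof.
apply: dual_norm_le => x x1; rewrite [X in `|X|](_ : _ = a * f x)// normrM.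
by rewrite ler_wpM2l// dual_norm_ub1.
Qed.

Let dual_normZ (a : R) f : dual_norm (a *: f) = `|a| * dual_norm f.
Proof.
apply/eqP; rewrite eq_le dual_normZ_le/=.
have [->|a0] := eqVneq a 0; first by rewrite normr0 mul0r dual_norm_ge0.
rewrite -ler_pdivlMl ?normr_gt0// -normfV.
by rewrite -[in leLHS](scale1r f) -(mulVf a0) -scalerA dual_normZ_le.
Qed.

Let dual_norm0_eq0 f : dual_norm f = 0 -> f = 0.
Proof.
move=> f0; apply: val_inj; apply/funext => x /=.
by apply/eqP; rewrite -normr_le0 (le_trans (dual_norm_ub f x))// f0 mul0r.
Qed.

HB.instance Definition _ :=
  Lmodule_isNormed.Build R dual dual_normD dual_normZ dual_norm0_eq0.

Lemma dual_normE (f : dual) :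
  `|f| = sup [set `|f x| | x in [set x : X | `|x| <= 1]].
Proof. by []. Qed.

(* As a type this is [dual X], but its topology is not the norm topology. *)
Definition weak_star_dual : Type :=
  initial_topology (dual_fun : dual -> {ptws X -> R^o}).

HB.instance Definition _ := Topological.on weak_star_dual.

Lemma weak_star_cvgP (v : nat -> dual) (w : dual) :
  (v : nat -> weak_star_dual) @ \oo --> (w : weak_star_dual) <->
  forall x, v k x @[k --> \oo] --> w x.
Proof.
split=> [vw x|vw].
  apply: (@cvg_comp _ _ _ v (fun u : dual => u x) \oo
    (nbhs (w : weak_star_dual)) _ vw).
  apply: (@cvg_comp _ _ _ (@dual_fun : weak_star_dual -> {ptws X -> R^o})
    (fun u => u x) _ _ _ (@initial_continuous dual {ptws X -> R^o} (@dual_fun) w)).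
  exact: (@proj_continuous X (fun=> R^o) x).
have vwp : {ptws, (fun k => v k : {ptws X -> R^o}) @ \oo --> (w : X -> R^o)}.
  by apply/(@pointwise_cvgP X R^o).
move=> A [_ [[B Bop <-] Bw] BA].
have : nbhs (dual_fun w : {ptws X -> R^o}) B by exact: open_nbhs_nbhs.
by move=> /vwp; apply: (@filterS _ \oo) => k; exact: BA.
Qed.

End Dual.

Section Submod.
Context {R : realType} {X : normedModType R} (S : submodClosed X).

Record submod := Submod { submod_val :> X ; _ : submod_val \in S }.

HB.instance Definition _ := [isSub for submod_val].
HB.instance Definition _ := [Choice of submod by <:].
HB.instance Definition _ := [SubChoice_isSubLmodule of submod by <:].

Let snorm (x : submod) : R := `|submod_val x|.
Let snormD x y : snorm (x + y) <= snorm x + snorm y.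
Proof. exact: ler_normD. Qed.
Let snormZ (a : R) x : snorm (a *: x) = `|a| * snorm x.
Proof. exact: normrZ. Qed.
Let snorm0_eq0 x : snorm x = 0 -> x = 0.
Proof. by move=> /normr0_eq0 x0; exact: val_inj. Qed.

HB.instance Definition _ :=
  Lmodule_isNormed.Build R submod snormD snormZ snorm0_eq0.

Lemma submod_normE (x : submod) : `|x| = `|submod_val x|.
Proof. by []. Qed.

End Submod.

Definition separable (T : topologicalType) :=
  exists2 D : set T, countable D & dense D.

Definition asplund {R : realType} (X : completeNormedModType R) :=
  forall S : submodClosed X, separable (submod S) ->
    separable (dual (submod S)).

Section SetValued.
Context {R : realType}.

Definition gph {X Y : Type} (F : X -> set Y) : set (X * Y) :=
  [set z | F z.1 z.2].

Definition svinv {X Y : Type} (F : X -> set Y) (y : Y) : set X :=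
  [set x | F x y].

Local Open Scope ereal_scope.

Definition dist_set {X : normedModType R} (x : X) (A : set X) : \bar R :=
  ereal_inf [set `|x - w|%:E | w in A].

Definition metrically_subregular {X Y : normedModType R} (q : R)
    (F : X -> set Y) (xbar : X) (ybar : Y) (eta : R) :=
  exists2 gamma : R, (0 < gamma)%R & forall x, closed_ball xbar gamma x ->
    dist_set x (svinv F ybar) <= eta%:E * dist_set ybar (F x) `^ q.

End SetValued.

Section Subdifferential.
Context {R : realType} {X : normedModType R}.
Implicit Types (f : X -> \bar R) (x : X).
Local Open Scope ereal_scope.

Definition dom f : set X := [set x | f x < +oo].

Definition regular_subdiff f x0 : set (dual X) :=
  [set v : dual X | dom f x0 /\
    0 <= limf_einf (fun x => (f x - f x0 - (v (x - x0))%:E)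
                             * (`|x - x0|^-1)%:E) x0^'].

Definition subdiff f x0 : set (dual X) :=
  [set v : dual X | dom f x0 /\
    exists (x : nat -> X) (xs : nat -> dual X),
      [/\ x @ \oo --> x0, f \o x @ \oo --> f x0,
          forall k, regular_subdiff f (x k) (xs k) &
          (xs : nat -> weak_star_dual X) @ \oo --> (v : weak_star_dual X)]].

Definition lsc_at f x :=
  forall a : R, a%:E < f x -> \forall y \near x, a%:E < f y.

Definition lsc_around f x0 := \forall x \near (x0 : X), lsc_at f x.

End Subdifferential.

Section Conditions.
Context {R : realType} {X : normedModType R}.
Variables (f : X -> \bar R) (xbar : X) (xsbar : dual X) (q : R).
Local Open Scope ereal_scope.

Local Notation d x := (dist_set x (svinv (subdiff f) xsbar)).

Definition subregular_with_minorant (ktilde : R) :=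
  let kappa := (q * ktilde `^ q^-1)%R in
  metrically_subregular q (subdiff f) xbar xsbar ktilde /\
  exists gamma r : R, [/\ (0 < gamma)%R, (0 < r < q / kappa)%R &
    forall x, closed_ball xbar gamma x ->
      f xbar + (xsbar (x - xbar))%:E
        - (q * r / (1 + q))%:E * d x `^ ((1 + q) / q) <= f x].

Definition growth (alpha eta : R) :=
  forall x, closed_ball xbar eta x ->
    f xbar + (xsbar (x - xbar))%:E
      + (q * alpha / (1 + q))%:E * d x `^ ((1 + q) / q) <= f x.

(* The library norms products with the max norm. *)
Definition sum_ball (r : R) : set (X * dual X) :=
  [set z | (`|z.1 - xbar| + `|z.2 - xsbar| <= r)%R].

Definition local_subgradient_estimate (eta beta : R) :=
  let rho := (eta + (q * eta / (1 + q)) `^ q^-1)%R in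
  forall (u x : X) (xs : dual X),
    (gph (subdiff f) `&` sum_ball rho) (u, xsbar) ->
    (gph (subdiff f) `&` sum_ball rho) (x, xs) ->
    f x + (xs (u - x))%:E
      - (q * beta / (1 + q))%:E * d x `^ ((1 + q) / q) <= f u.

End Conditions.

(* Main.v *)
(* Part (a): for [x] near [xbar] and [x*] in the subdifferential at [x], the
   estimate applied at ([u], [x]) and at ([xbar], [u]), with [u] an almost
   nearest point of [S := (subdiff f)^-1 xsbar], turns the growth condition into
   [const * d(x; S)^(1 + 1/q) <= |x* - xsbar| d(x; S)].

   Part (b): put [g x := f x - f xbar - xsbar (x - xbar)].  By subregularity, [g]
   cannot satisfy [g >= g y - L |. - y|] near a point [y] close to [xbar] unless
   [d(y; S) <= ktilde L^q]; a violation of the growth condition is contradicted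
   by an almost minimizer of [g] plus a multiple of
   [|d(.; S)^(1 + 1/q) - d(x0; S)^(1 + 1/q)|], obtained from Ekeland's principle.

   The transfer from slopes to subgradients uses that [X] is Asplund.  On a
   separable subspace, whose dual has a dense sequence [e n], the function
   [p |-> sum_n w_n |p - e n|^2] on the dual ball is locally uniformly rotund, so
   its conjugate is a Frechet smooth approximation of the norm; a variational
   principle of Borwein-Preiss type with these functions yields a minimizer of
   [f + G], [G] convex and smooth.  By Hahn-Banach, the existence of a Frechet
   subgradient of bounded norm is equivalent to the absence of a finite
   certificate of the contrary, and the separable subspace can be chosen such
   that certificates in [X] at its points already exist inside it. *)

Require Import Defs.
From HB Require Import structures.
From mathcomp Require Import all_boot all_order all_algebra.
From mathcomp Require Import all_classical all_reals all_analysis.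
From mathcomp Require Import ring lra.

Set Implicit Arguments.
Unset Strict Implicit.
Unset Printing Implicit Defensive.

Import Order.TTheory GRing.Theory Num.Theory.
Import numFieldNormedType.Exports.
Local Open Scope classical_set_scope.
Local Open Scope ring_scope.

(** * Sublinear functionals and the Hahn-Banach theorem *)

Section HahnBanach.
Context {R : realType} {V : lmodType R}.
Implicit Types p q : V -> R.

Definition sublinear p :=
  (forall x y, p (x + y) <= p x + p y) /\
  (forall a x, 0 < a -> p (a *: x) <= a * p x).

Lemma sublinearZ p a x : sublinear p -> 0 < a -> p (a *: x) = a * p x.
Proof.
move=> [_ pZ] a0; apply/eqP; rewrite eq_le pZ//=.
rewrite -ler_pdivlMl//; have := pZ a^-1 (a *: x).
by rewrite invr_gt0 scalerA mulVf ?gt_eqF// scale1r; apply.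
Qed.

Lemma sublinear0 p : sublinear p -> p 0 = 0.
Proof.
move=> sp; have := sublinearZ 0 sp (ltr0Sn R 1).
by rewrite scaler0 => p0; lra.
Qed.

Lemma sublinear_lb p x : sublinear p -> - p (- x) <= p x.
Proof.
move=> sp; have := sp.1 x (- x); rewrite subrr sublinear0// => ?; lra.
Qed.

Definition sublinear_below p := {q : V -> R | sublinear q /\ forall x, q x <= p x}.

(** Zorn's lemma for the reversed pointwise order. The infimum of a chain is finite because a
    sublinear [s <= p] satisfies [s x >= - s (- x) >= - p (- x)], and it is subadditive because two
    members of the chain can be replaced by the smaller one. *)
Lemma exists_minimal_sublinear p : sublinear p ->
  exists q, [/\ sublinear q, forall x, q x <= p x &
    forall r, sublinear r -> (forall x, r x <= q x) -> r = q].
Proof.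
move=> sp; pose T := sublinear_below p.
pose Rel (s t : T) := `[< forall x, sval t x <= sval s x >].
have [||||[q [sq qp]] qmin] := @Zorn T Rel.
- by move=> t; apply/asboolP.
- move=> r s t /asboolP rs /asboolP st; apply/asboolP => x.
  exact: le_trans (st x) (rs x).
- move=> [s Ps] [t Pt] /asboolP/= st /asboolP/= ts; apply/eq_exist => /=.
  by apply/funext => x; apply/eqP; rewrite eq_le st ts.
- move=> A Atot; have [A0|/set0P[s0 As0]] := eqVneq A set0.
    have pp : sublinear p /\ forall x, p x <= p x by [].
    by exists (exist _ p pp) => s; rewrite A0.
  pose E x := [set sval s x | s in A].
  have Elb x : has_lbound (E x).
    exists (- p (- x)) => _ [[s [ss sp']] _ <-] /=.
    by apply: le_trans (sublinear_lb x ss); rewrite lerN2.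
  have E0 x : E x !=set0 by exists (sval s0 x), s0.
  pose t x := inf (E x).
  have tE s x : A s -> t x <= sval s x by move=> As; apply: ge_inf => //; exists s.
  have st : sublinear t.
    split=> [x y|a x a0].
      have h s1 s2 : A s1 -> A s2 -> t (x + y) <= sval s1 x + sval s2 y.
        move=> A1 A2; case: (Atot _ _ A1 A2) => /asboolP h.
          apply: (le_trans (tE _ _ A2)).
          by apply: (le_trans ((svalP s2).1.1 x y)); rewrite lerD2r.
        apply: (le_trans (tE _ _ A1)).
        by apply: (le_trans ((svalP s1).1.1 x y)); rewrite lerD2l.
      rewrite -lerBlDr; apply: (@lb_le_inf _ (E x)) => // _ [s1 A1 <-].
      rewrite lerBlDr [leRHS]addrC -lerBlDr; apply: (@lb_le_inf _ (E y)) => // _ [s2 A2 <-].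
      by rewrite lerBlDr [leRHS]addrC h.
    rewrite -ler_pdivrMl//; apply: (@lb_le_inf _ (E x)) => // _ [s As <-].
    rewrite ler_pdivrMl//; apply: (le_trans (tE _ _ As)).
    exact: (svalP s).1.2.
  have tp x : t x <= p x by apply: (le_trans (tE _ x As0)); exact: (svalP s0).2.
  exists (exist _ t (conj st tp)) => s As; apply/asboolP => x /=; exact: tE.
- exists q; split=> // r sr rq.
  have rp x : r x <= p x by exact: le_trans (rq x) (qp x).
  have := qmin (exist _ r (conj sr rp)); move=> /(_ _)/(congr1 sval)/=; apply.
  by apply/asboolP.
Qed.

(* Minimality of [q] against [h |-> inf_(t >= 0) q (h + t x) - t q x] gives
   additivity. *)
Lemma exists_linear_le_sublinear p : sublinear p ->
  exists v : V -> R, (linear (v : V -> R^o)) /\ forall x, v x <= p x.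
Proof.
move=> /exists_minimal_sublinear[q [sq qp qmin]].
have qD x y : q (x + y) = q x + q y.
  pose E h := [set q (h + t *: y) - t * q y | t in [set t : R | 0 <= t]].
  have Elb h : has_lbound (E h).
    exists (- q (- h)) => _ [t /= t0 <-].
    have := sq.1 (h + t *: y) (- h); rewrite addrAC subrr add0r.
    have [->|tn0] := eqVneq t 0.
      by rewrite scale0r addr0 (sublinear0 sq) mul0r => ?; lra.
    by rewrite (sublinearZ _ sq) ?lt0r ?tn0// => ?; lra.
  have E0 h : E h !=set0 by exists (q (h + 0 *: y) - 0 * q y), 0 => /=.
  pose r h := inf (E h).
  have rE h t : 0 <= t -> r h <= q (h + t *: y) - t * q y.
    by move=> t0; apply: ge_inf => //; exists t.
  have sr : sublinear r.
    split=> [h k|a h a0].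
      rewrite -lerBlDr; apply: (@lb_le_inf _ (E h)) => // _ [t /= t0 <-].
      rewrite lerBlDr [leRHS]addrC -lerBlDr; apply: (@lb_le_inf _ (E k)) => // _ [s /= s0 <-].
      rewrite lerBlDr; apply: (le_trans (rE (h + k) (t + s) _)).
        exact: addr_ge0.
      rewrite scalerDl addrACA; have := sq.1 (h + t *: y) (k + s *: y).
      by move=> ?; lra.
    rewrite -ler_pdivrMl//; apply: (@lb_le_inf _ (E h)) => // _ [t /= t0 <-].
    rewrite ler_pdivrMl//; apply: (le_trans (rE (a *: h) (a * t) _)).
      by rewrite mulr_ge0// ltW.
    by rewrite -scalerA -scalerDr (sublinearZ _ sq)// mulrBr mulrA.
  have rq h : r h <= q h.
    by apply: (le_trans (rE h 0 _)) => //; rewrite scale0r addr0 mul0r subr0.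
  have := rE x 1 ler01; rewrite (qmin r sr rq) scale1r mul1r => h.
  by apply/eqP; rewrite eq_le sq.1/=; lra.
have qN x : q (- x) = - q x.
  by have := qD x (- x); rewrite subrr (sublinear0 sq) => ?; lra.
exists q; split=> // a x y; rewrite qD; congr (_ + _).
have [a0|a0|->] := ltgtP a 0.
- rewrite -[a in LHS]opprK scaleNr qN (sublinearZ _ sq) ?oppr_gt0//.
  by rewrite mulNr opprK.
- by rewrite (sublinearZ _ sq).
- by rewrite !scale0r (sublinear0 sq).
Qed.

End HahnBanach.

(** * Functionals under linear constraints and a norm bound *)

Section Sandwich.
Context {R : realType} {X : normedModType R}.
Implicit Types (v : dual X) (x h : X).

Lemma exists_dual (u : X -> R) c : (linear (u : X -> R^o)) ->
  (forall x, u x <= c * `|x|) -> exists v, forall x, v x = u x :> R.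
Proof.
move=> lu uc.
pose ul := GRing.isLinear.Build R X R^o _ (u : X -> R^o) lu.
pose U : {linear X -> R^o} := HB.pack (u : X -> R^o) ul.
have uab x : `|u x| <= c * `|x|.
  rewrite ler_norml uc andbT.
  have := uc (- x); rewrite normrN -[u _]/(U (- x)) linearN => h.
  by rewrite lerNl.
have cu : continuous (U : X -> R^o).
  apply/linear_bounded_continuous/bounded_funP => r.
  exists (`|c| * r) => x xr; apply: (le_trans (uab x)).
  by apply: (@le_trans _ _ (`|c| * `|x|)); rewrite ?ler_wpM2r ?ler_wpM2l ?ler_norm.
have du : (u : X -> R^o) \in @dual_pred R X by apply/asboolP; split.
by exists (Dual du).
Qed.

(** A pair [(h, t)] stands for the constraint [v h <= t] on a functional [v]; the cone lists the
    consequences obtained by nonnegative combination. *)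
Inductive cone (B : X -> R -> Prop) : X -> R -> Prop :=
| cone0 : cone B 0 0
| coneD a h t k s : 0 <= a -> B h t -> cone B k s ->
    cone B (a *: h + k) (a * t + s).

Lemma cone_add B h t k s : cone B h t -> cone B k s -> cone B (h + k) (t + s).
Proof.
elim=> [|a h' t' k' s' a0 Bh _ IH] ck; first by rewrite !add0r.
by rewrite -!addrA; apply: coneD => //; exact: IH.
Qed.

Lemma cone_scale B a h t : 0 <= a -> cone B h t -> cone B (a *: h) (a * t).
Proof.
move=> a0; elim=> [|b h' t' k' s' b0 Bh _ IH].
  by rewrite scaler0 mulr0; exact: cone0.
rewrite scalerDr mulrDr scalerA mulrA; apply: coneD => //; exact: mulr_ge0.
Qed.

(** The hypothesis says that no consequence [v h <= t] contradicts [v h >= - c |h|]. It makes the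
    infimum over the cone of [s + c |h - k|] finite and sublinear in [h]; a linear functional below
    it obeys the norm bound through [k = 0] and each constraint through [k = h]. *)
Lemma sandwich B c : 0 <= c ->
  (forall h t, cone B h t -> 0 <= t + c * `|h|) ->
  exists v, (forall h, `|v h| <= c * `|h|) /\ (forall h t, B h t -> v h <= t).
Proof.
move=> c0 Bc.
pose E h := [set z | exists k s, cone B k s /\ z = s + c * `|h - k|].
have Elb h : has_lbound (E h).
  exists (- (c * `|h|)) => _ [k [s [ck ->]]]; have := Bc _ _ ck.
  have : c * `|k| <= c * `|h| + c * `|h - k|.
    rewrite -mulrDr ler_wpM2l// -[X in `|X| <= _](subKr h).
    exact: ler_normB.
  by move=> ? ?; lra.
have E0 h : E h !=set0 by exists (0 + c * `|h - 0|), 0, 0; split => //; exact: cone0.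
pose p h := inf (E h).
have pE h k s : cone B k s -> p h <= s + c * `|h - k|.
  by move=> ck; apply: ge_inf => //; exists k, s.
have sp : sublinear p.
  split=> [h k|a h a0].
    rewrite -lerBlDr; apply: (@lb_le_inf _ (E h)) => // _ [h' [t [ch ->]]].
    rewrite lerBlDr [leRHS]addrC -lerBlDr; apply: (@lb_le_inf _ (E k)) => // _ [k' [s [ck ->]]].
    rewrite lerBlDr; apply: (le_trans (pE _ _ _ (cone_add ch ck))).
    have : c * `|h + k - (h' + k')| <= c * `|h - h'| + c * `|k - k'|.
      by rewrite -mulrDr ler_wpM2l// opprD addrACA ler_normD.
    by move=> ?; lra.
  rewrite -ler_pdivrMl//; apply: (@lb_le_inf _ (E h)) => // _ [h' [t [ch ->]]].
  rewrite ler_pdivrMl//; apply: (le_trans (pE _ _ _ (cone_scale (ltW a0) ch))).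
  by rewrite -scalerBr normrZ gtr0_norm// mulrDr mulrCA.
have [u [lu up]] := exists_linear_le_sublinear sp.
have uc h : u h <= c * `|h|.
  apply: (le_trans (up h)); apply: (le_trans (pE h 0 0 (cone0 B))).
  by rewrite subr0 add0r.
have [v vu] := exists_dual lu uc.
exists v; split=> [h|h t Bh]; last first.
  rewrite vu; apply: (le_trans (up h)).
  have := coneD ler01 Bh (cone0 B); rewrite scale1r mul1r !addr0 => ch.
  by apply: (le_trans (pE _ _ _ ch)); rewrite subrr normr0 mulr0 addr0.
rewrite ler_norml vu uc andbT; have := uc (- h).
by rewrite normrN -vu linearN => ?; rewrite lerNl -vu.
Qed.

(** The single constraint [v (- x) <= - |x|] is compatible with the norm bound 1, since its
    multiples all satisfy [t = - |h|]. *)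
Lemma norming x : exists v, (forall h, `|v h| <= `|h|) /\ v x = `|x| :> R.
Proof.
pose B h t := h = - x /\ t = - `|x|.
have cB h t : cone B h t -> t = - `|h|.
  suff : cone B h t -> exists2 a : R, 0 <= a & h = - (a *: x) /\ t = - (a * `|x|).
    move=> + ch => /(_ ch)[a a0 [-> ->]].
    by rewrite normrN normrZ ger0_norm.
  elim=> [|a h' t' k s a0 [-> ->] _ [b b0 [-> ->]]].
    by exists 0; rewrite // scale0r mul0r !oppr0.
  exists (a + b); first exact: addr_ge0.
  by rewrite scalerN mulrN -!opprD -scalerDl -mulrDl.
have [h t /cB ->|v [vc vB]] := @sandwich B 1 ler01; first by rewrite mul1r addNr.
exists v; split=> [h|]; first by have := vc h; rewrite mul1r.
apply/eqP; rewrite eq_le; have := vc x; rewrite mul1r ler_norml => /andP[_ ->]/=.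
by have := vB _ _ (conj erefl erefl); rewrite linearN lerN2.
Qed.

End Sandwich.

(** * Limits along an ultrafilter *)

Section UltraLimit.
Context {R : realType}.

Lemma ultra_bounded_cvg (U : set_system nat) (UU : UltraFilter U)
    (u : nat -> R) M : (forall k, `|u k| <= M) -> exists l : R, u k @[k --> U] --> l.
Proof.
move=> uM; pose F : set_system R := fmap u U.
have FM : F `[- M, M]%classic.
  by apply: (@filterS _ U _ setT _ _ filterT) => k _; rewrite /= in_itv/= -ler_norml.
have [l [_ lcl]] := @segment_compact R (- M) M F _ FM.
exists l => B Bl; have [//|UB] := in_ultra_setVsetC (u @^-1` B) UU.
by have [z []] := lcl (~` B) B UB Bl.
Qed.

(** Weak-star compactness of the dual ball: along an ultrafilter the bounded scalars [p k h]
    converge for every [h], and the limit inherits linearity and the norm bound. *)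
Lemma dual_ultra_limit (T : normedModType R) (U : set_system nat)
    (UU : UltraFilter U) (p : nat -> dual T) :
  (forall k h, `|p k h| <= `|h|) ->
  exists p0 : dual T, (forall h, `|p0 h| <= `|h|) /\
    forall h, p k h @[k --> U] --> p0 h.
Proof.
move=> p1; have lims h := ultra_bounded_cvg UU (fun k => p1 k h).
have [u uP] := choice lims.
have lu : linear (u : T -> R^o).
  move=> a x y; apply: (@cvg_unique _ _ (p k (a *: x + y) @[k --> U])) => //.
    exact: uP.
  rewrite /= (_ : (fun k => p k (a *: x + y) : R) = (fun k => a * p k x + p k y)).
    by apply: cvgD; [apply: cvgZr|]; exact: uP.
  by apply/funext => k; exact: dual_linear.
have u1 h : `|u h| <= `|h|.
  apply: (cvgr_to_le (cvg_norm (uP h))).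
  by apply: nearW => k; exact: p1.
have [|p0 p0u] := @exists_dual R T u 1 lu.
  by move=> h; rewrite mul1r (le_trans (ler_norm _)).
by exists p0; split=> h; rewrite p0u.
Qed.

End UltraLimit.

(** * Smooth approximation of the norm by conjugating a rotund function *)

Lemma sum_gap (R : realType) (a b : nat -> R) (c : R) n M : (n < M)%N ->
  (forall i, a i <= b i) -> a n + c <= b n ->
  \sum_(i < M) a i + c <= \sum_(i < M) b i.
Proof.
move=> nM ab abn; rewrite (bigD1 (Ordinal nM))//= [leRHS](bigD1 (Ordinal nM))//=.
by rewrite addrAC lerD// ler_sum.
Qed.

Section SmoothNorm.
Context {R : realType} {T : normedModType R}.
Implicit Types (p q : dual T) (x z h : T) (G : T -> R).

Definition convex_on_space G := forall x y (t : R), 0 <= t <= 1 ->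
  G (t *: x + (1 - t) *: y) <= t * G x + (1 - t) * G y.

(* For convex [G], the second clause is Frechet differentiability at [z]. *)
Definition smooth_convex G := convex_on_space G /\
  forall z e, 0 < e -> exists2 d : R, 0 < d &
    forall h, `|h| < d -> G (z + h) + G (z - h) - 2 * G z <= e * `|h|.

Lemma dual_norm_le p c : (forall h, `|p h| <= c * `|h|) -> 0 <= c -> `|p| <= c.
Proof.
move=> pc c0; rewrite dual_normE; apply: ge_sup.
  by exists `|p 0|, 0 => //=; rewrite normr0.
move=> _ [h /= h1 <-]; apply: (le_trans (pc h)).
by rewrite -[leRHS]mulr1 ler_wpM2l.
Qed.

Lemma dual_norm_le1 p : (forall h, `|p h| <= `|h|) <-> `|p| <= 1.
Proof.
split=> [p1|p1 h]; first by apply: dual_norm_le => // h; rewrite mul1r.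
by apply: (le_trans (dual_norm_ub p h)); rewrite -[leRHS]mul1r ler_wpM2r.
Qed.

Variable e : nat -> dual T.
Hypothesis e_dense : forall p (r : R), 0 < r -> exists n, `|p - e n| < r.

(** On the dual unit ball [|p - e n| <= 1 + |e n|], so this weight bounds the [n]-th term of the
    series by [2^-(n+1)] and the sum by 1. *)
Definition lur_weight n : R := 2^-1 ^+ n.+1 / (1 + `|e n|) ^+ 2.

Lemma lur_weight_gt0 n : 0 < lur_weight n.
Proof. by rewrite divr_gt0// exprn_gt0// ltr_wpDr. Qed.

Definition lur_sum N p := \sum_(i < N) lur_weight i * `|p - e i| ^+ 2.

Definition lur p := sup [set lur_sum N p | N in setT].

Lemma lur_sum_ge0 N p : 0 <= lur_sum N p.
Proof.
by apply: sumr_ge0 => i _; rewrite mulr_ge0 ?sqr_ge0// ltW// lur_weight_gt0.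
Qed.

Lemma lur_sum_le1 N p : `|p| <= 1 -> lur_sum N p <= 1.
Proof.
move=> p1; apply: (@le_trans _ _ (1 - 2^-1 ^+ N)); last first.
  by rewrite gerBl exprn_ge0.
elim: N => [|N IH]; first by rewrite /lur_sum big_ord0 expr0 subrr.
rewrite /lur_sum big_ord_recr/= -/(lur_sum N p).
suff : lur_weight N * `|p - e N| ^+ 2 <= 2^-1 ^+ N.+1.
  move: IH; rewrite (exprS _ N) => ? ?; lra.
have e1 : 0 < (1 + `|e N|) ^+ 2 by rewrite exprn_gt0// ltr_wpDr.
rewrite /lur_weight mulrAC ler_pdivrMr// ler_wpM2l//.
rewrite lerXn2r ?nnegrE ?addr_ge0//.
by apply: (le_trans (ler_normB _ _)); rewrite lerD2r.
Qed.

Lemma lur_sum_mono N M p : (N <= M)%N -> lur_sum N p <= lur_sum M p.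
Proof.
move=> NM; rewrite -(subnKC NM); elim: (M - N)%N => [|k IH]; first by rewrite addn0.
rewrite addnS; apply: (le_trans IH).
rewrite {2}/lur_sum big_ord_recr/= lerDl mulr_ge0 ?sqr_ge0// ltW//.
exact: lur_weight_gt0.
Qed.

Lemma lur_has_ub p : `|p| <= 1 -> has_ubound [set lur_sum N p | N in setT].
Proof. by move=> p1; exists 1 => _ [N _ <-]; exact: lur_sum_le1. Qed.

Lemma lur_sum_le N p : `|p| <= 1 -> lur_sum N p <= lur p.
Proof. by move=> p1; apply: ub_le_sup; [exact: lur_has_ub|exists N]. Qed.

Lemma lur_le p c : (forall N, lur_sum N p <= c) -> lur p <= c.
Proof.
move=> pc; apply: ge_sup; first by exists (lur_sum 0 p), 0%N.
by move=> _ [N _ <-].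
Qed.

Lemma lur_ge0 p : `|p| <= 1 -> 0 <= lur p.
Proof. by move=> p1; rewrite (le_trans (lur_sum_ge0 0 p))// lur_sum_le. Qed.

Lemma lur_le1 p : `|p| <= 1 -> lur p <= 1.
Proof. by move=> p1; apply: lur_le => N; exact: lur_sum_le1. Qed.

(** Termwise, [|m - e i|] is at most the mean of [a = |p - e i|] and [b = |q - e i|], and [((a + b)
    / 2)^2 + (a - b)^2 / 4 = (a^2 + b^2) / 2]. The defect is kept for the index [n] and dropped
    elsewhere. *)
Lemma lur_midpoint p q n : `|p| <= 1 -> `|q| <= 1 ->
  lur (2^-1 *: (p + q)) + lur_weight n / 4 * (`|p - e n| - `|q - e n|) ^+ 2
  <= (lur p + lur q) / 2.
Proof.
move=> p1 q1; pose m := 2^-1 *: (p + q).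
have mi i : `|m - e i| <= (`|p - e i| + `|q - e i|) / 2.
  have -> : m - e i = 2^-1 *: ((p - e i) + (q - e i)).
    have ee : 2^-1 *: (e i + e i) = e i.
      by rewrite -[e i]scale1r -scalerDl scalerA mulVf// scale1r.
    by rewrite addrACA -opprD scalerBr ee.
  by rewrite normrZ gtr0_norm// mulrC ler_wpM2r// ler_normD.
have sq i : lur_weight i * `|m - e i| ^+ 2 +
    lur_weight i / 4 * (`|p - e i| - `|q - e i|) ^+ 2 <=
    (lur_weight i * `|p - e i| ^+ 2 + lur_weight i * `|q - e i| ^+ 2) / 2.
  have h : `|m - e i| ^+ 2 <= ((`|p - e i| + `|q - e i|) / 2) ^+ 2.
    by rewrite lerXn2r ?nnegrE ?divr_ge0 ?addr_ge0.
  have := ler_wpM2l (ltW (lur_weight_gt0 i)) h.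
  set w := lur_weight i; set a := `|p - e i|; set b := `|q - e i|.
  have -> : (w * a ^+ 2 + w * b ^+ 2) / 2 =
      w * ((a + b) / 2) ^+ 2 + w / 4 * (a - b) ^+ 2 by field.
  by rewrite lerD2r.
rewrite -lerBrDr; apply: lur_le => N; rewrite lerBrDr.
(* Partial sums up to [M] contain the first [N] terms and the term of index [n]. *)
set M := maxn N n.+1.
apply: (@le_trans _ _ ((lur_sum M p + lur_sum M q) / 2)); last first.
  by rewrite ler_wpM2r// lerD// lur_sum_le.
have NM : (N <= M)%N by rewrite leq_maxl.
have nM : (n < M)%N by rewrite leq_maxr.
apply: (le_trans (lerD (lur_sum_mono m NM) (lexx _))).
have -> : (lur_sum M p + lur_sum M q) / 2 = \sum_(i < M)
    (lur_weight i * `|p - e i| ^+ 2 + lur_weight i * `|q - e i| ^+ 2) / 2.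
  by rewrite -mulr_suml big_split.
apply: (@sum_gap _ (fun i => lur_weight i * `|m - e i| ^+ 2)
  (fun i => (lur_weight i * `|p - e i| ^+ 2 + lur_weight i * `|q - e i| ^+ 2) / 2)
  _ _ _ nM _ (sq n)) => i; apply: le_trans (sq i).
by rewrite lerDl mulr_ge0 ?sqr_ge0// divr_ge0// ltW// lur_weight_gt0.
Qed.

(** The Fenchel conjugate at [x] of [s * lur] restricted to the dual unit ball; for [s = 0] it would
    be the norm. *)
Definition smooth_norm s x :=
  sup [set ((p : dual T) x : R) - s * lur p | p in [set p : dual T | `|p| <= 1]].

Lemma smooth_norm_has_ub s x : 0 < s ->
  has_ubound
    [set ((p : dual T) x : R) - s * lur p | p in [set p : dual T | `|p| <= 1]].
Proof.
move=> s0; exists `|x| => _ [p /= p1 <-].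
have := mulr_ge0 (ltW s0) (lur_ge0 p1).
have := le_trans (ler_norm _) ((dual_norm_le1 p).2 p1 x).
by move=> ? ?; lra.
Qed.

Lemma smooth_norm_ge s x p : 0 < s -> `|p| <= 1 ->
  (p x : R) - s * lur p <= smooth_norm s x.
Proof.
by move=> s0 p1; apply: ub_le_sup; [exact: smooth_norm_has_ub|exists p].
Qed.

Lemma smooth_norm_adherent s x r : 0 < s -> 0 < r ->
  exists2 p : dual T, `|p| <= 1 & smooth_norm s x - r < (p x : R) - s * lur p.
Proof.
move=> s0 r0.
have [|_ [p /= p1 <-] h] := sup_adherent r0 (conj _ (smooth_norm_has_ub x s0)).
  by exists (((0 : dual T) x : R) - s * lur 0), 0 => //=; rewrite normr0.
by exists p.
Qed.

Lemma smooth_norm_leP s x c :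
  (forall p, `|p| <= 1 -> (p x : R) - s * lur p <= c) -> smooth_norm s x <= c.
Proof.
move=> h; apply: ge_sup; last by move=> _ [p /= p1 <-]; exact: h.
by exists (((0 : dual T) x : R) - s * lur 0), 0 => //=; rewrite normr0.
Qed.

Lemma smooth_norm_le s x : 0 < s -> smooth_norm s x <= `|x|.
Proof.
move=> s0; apply: smooth_norm_leP => p p1.
have := mulr_ge0 (ltW s0) (lur_ge0 p1).
have := le_trans (ler_norm _) ((dual_norm_le1 p).2 p1 x).
by move=> ? ?; lra.
Qed.

Lemma le_smooth_norm s x : 0 < s -> `|x| - s <= smooth_norm s x.
Proof.
move=> s0; have [p [/dual_norm_le1 p1 px]] := norming x.
apply: le_trans (smooth_norm_ge x s0 p1); rewrite px lerD2l lerN2.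
by rewrite -[leRHS]mulr1 ler_wpM2l ?lur_le1// ltW.
Qed.

Lemma smooth_norm_lipschitz s x y : 0 < s ->
  `|smooth_norm s x - smooth_norm s y| <= `|x - y|.
Proof.
move=> s0; have h a b : smooth_norm s a - smooth_norm s b <= `|a - b|.
  rewrite lerBlDr; apply: smooth_norm_leP => p p1.
  have := smooth_norm_ge b s0 p1.
  have := le_trans (ler_norm _) ((dual_norm_le1 p).2 p1 (a - b)).
  by rewrite linearB/= => ? ?; lra.
by rewrite ler_norml h andbT lerNl opprB -normrN opprB h.
Qed.

Lemma smooth_norm_convex s : 0 < s -> convex_on_space (smooth_norm s).
Proof.
move=> s0 x y t /andP[t0 t1]; apply: smooth_norm_leP => p p1.
rewrite linearD !linearZ/=.
have := ler_wpM2l t0 (smooth_norm_ge x s0 p1).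
have : 0 <= 1 - t by rewrite subr_ge0.
move/ler_wpM2l => /(_ _ _ (smooth_norm_ge y s0 p1)).
by rewrite /GRing.scale/= => ? ?; lra.
Qed.

(** Almost maximizers have a pointwise limit [p0] along an ultrafilter, and [lur] is lower
    semicontinuous along it. *)
Lemma smooth_norm_attained s x : 0 < s ->
  exists2 p : dual T, `|p| <= 1 & smooth_norm s x <= (p x : R) - s * lur p.
Proof.
move=> s0; set P := smooth_norm s x.
have ex k : exists p, `|p| <= 1 /\ P - k.+1%:R^-1 < (p x : R) - s * lur p.
  have [|p p1 h] := @smooth_norm_adherent s x k.+1%:R^-1 s0.
    by rewrite invr_gt0.
  by exists p.
have [p pP] := choice ex.
have [U [UU Uoo]] := ultraFilterLemma (eventually_filter).
have p1 k h : `|p k h| <= `|h| by apply: (dual_norm_le1 _).2; exact: (pP k).1.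
have [p0 [p01 pp0]] := dual_ultra_limit UU p1.
exists p0; first exact/dual_norm_le1.
suff h N : s * lur_sum N p0 <= (p0 x : R) - P.
  rewrite lerBrDr addrC -lerBrDr mulrC -ler_pdivlMr//.
  by apply: lur_le => N; rewrite ler_pdivlMr// mulrC.
(* The limit of the partial sums dominates the partial sum at [p0] because [|p0 - e N|] is at most
   the limit of [|p k - e N|]. *)
have [l lN lp0] : exists2 l, lur_sum N (p k) @[k --> U] --> l & lur_sum N p0 <= l.
  elim: N => [|N [l lN lp0]].
    exists 0; last by rewrite /lur_sum big_ord0.
    by under eq_fun do rewrite /lur_sum big_ord0; exact: cvg_cst.
  have bd k : `| `|p k - e N| | <= 1 + `|e N|.
    by rewrite normr_id (le_trans (ler_normB _ _))// lerD2r (pP k).1.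
  have [a aN] := ultra_bounded_cvg UU bd.
  have a0 : 0 <= a by apply: (cvgr_to_ge aN); exact: nearW.
  have p0a : `|p0 - e N| <= a.
    apply: dual_norm_le => // h.
    have c1 : `|(p k h : R) - e N h| @[k --> U] --> `|(p0 h : R) - e N h|.
      by apply: cvg_norm; apply: cvgB => //; exact: cvg_cst.
    have c2 : `|p k - e N| * `|h| @[k --> U] --> a * `|h|.
      by apply: cvgM => //; exact: cvg_cst.
    apply: (ler_cvg_to c1 c2); apply: nearW => k.
    exact: (dual_norm_ub (p k - e N) h).
  exists (l + lur_weight N * a ^+ 2).
    under eq_fun do rewrite /lur_sum big_ord_recr/=.
    apply: cvgD => //; apply: cvgM; first exact: cvg_cst.
    by under eq_fun do rewrite expr2; rewrite expr2; exact: cvgM.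
  rewrite /lur_sum big_ord_recr/= lerD// ler_wpM2l ?(ltW (lur_weight_gt0 N))//.
  by rewrite lerXn2r ?nnegrE.
apply: (@le_trans _ _ (s * l)); first by rewrite ler_wpM2l// ltW.
have c1 : s * lur_sum N (p k) @[k --> U] --> s * l.
  by apply: cvgM => //; exact: cvg_cst.
have c2 : (p k x : R) - P + k.+1%:R^-1 @[k --> U] --> (p0 x : R) - P + 0.
  apply: cvgD; first by apply: cvgB => //; exact: cvg_cst.
  by apply: cvg_trans (@cvg_harmonic R) => A; exact: Uoo.
rewrite -[leRHS]addr0; apply: (ler_cvg_to c1 c2); apply: nearW => k.
have := (pP k).2; have := ler_wpM2l (ltW s0) (lur_sum_le N (pP k).1).
move: (k.+1%:R^-1) (lur (p k)) (lur_sum N (p k)) (p k x : R).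
by clearbody P; clear => *; lra.
Qed.

(* Local uniform rotundity: picking [n] with [e n] close to the maximizer [p0],
   the midpoint inequality forces [`|p - e n|] to be small for every
   almost maximizer [p]. *)
Lemma smooth_norm_slices s x (r : R) : 0 < s -> 0 < r ->
  exists p0 : dual T, exists2 d : R, 0 < d & forall p, `|p| <= 1 ->
    smooth_norm s x - d <= (p x : R) - s * lur p -> `|p - p0| <= r.
Proof.
move=> s0 r0; have [p0 p01 p0x] := smooth_norm_attained x s0.
have [n p0n] := e_dense p0 (divr_gt0 r0 (ltr0Sn R 2)).
have w0 := lur_weight_gt0 n.
(* With this gap the midpoint inequality gives [|p - e n| <= |p0 - e n| + r / 3], where
   [|p0 - e n| < r / 3]. *)
exists p0, (s * (lur_weight n / 2) * (r / 3) ^+ 2).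
  by rewrite !mulr_gt0// exprn_gt0// divr_gt0.
move=> p p1 px.
have m1 : `|2^-1 *: (p + p0)| <= 1.
  rewrite normrZ gtr0_norm// mulrC ler_pdivrMr// mul1r.
  by rewrite (le_trans (ler_normD _ _))// -[2]/(1 + 1)%R lerD.
have := smooth_norm_ge x s0 m1.
rewrite [X in X - _ <= _](_ : _ = ((p x : R) + p0 x) / 2); last first.
  by rewrite mulrC.
have := ler_wpM2l (ltW s0) (lur_midpoint n p1 p01).
set d := `|p - e n| - `|p0 - e n|; set L := lur _ => mid top.
have {mid top} : s * (lur_weight n / 4) * d ^+ 2 <= s * (lur_weight n / 4) * (r / 3) ^+ 2.
  move: p0x px mid top; move: (smooth_norm s x) (lur p) (lur p0) L => P a b {}L.
  by move: (lur_weight n) d (p x : R) (p0 x : R); clear => *; lra.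
rewrite ler_pM2l ?mulr_gt0 ?divr_gt0// -[d ^+ 2]real_normK ?num_real//.
have r3 : 0 <= r / 3 by rewrite ltW// divr_gt0.
rewrite ler_sqr ?nnegrE// => /(le_trans (ler_norm _)).
rewrite /d => dr.
have -> : p - p0 = (p - e n) - (p0 - e n) by rewrite opprB addrA subrK.
apply: (le_trans (ler_normB _ _)); move: dr p0n.
by move: (`|p - e n|) (`|p0 - e n|); clear -r => a b *; lra.
Qed.

(** Almost maximizers [p] at [z + h] and [q] at [z - h] are almost maximizers at [z], hence within
    [r / 2] of each other; the second difference is at most [(p - q) h + r / 2 * |h|]. *)
Lemma smooth_norm_smooth s : 0 < s -> smooth_convex (smooth_norm s).
Proof.
move=> s0; split=> [|z r r0]; first exact: smooth_norm_convex.
have [p0 [d d0 dP]] := smooth_norm_slices z s0 (divr_gt0 r0 (ltr0Sn R 3)).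
(* A functional within [r / 4 * |h|] of the supremum at [z + k], with [|k| = |h|], is within
   [(2 + r / 4) * |h|] of it at [z], as the functional and the supremum are 1-Lipschitz. *)
exists (d / (2 + r / 4)); first by rewrite divr_gt0 ?addr_gt0 ?divr_gt0.
move=> h; rewrite ltr_pdivlMr ?addr_gt0 ?divr_gt0// => hd.
have [->|h0] := eqVneq h 0.
  by rewrite addr0 subr0 normr0 mulr0; lra.
have rh : 0 < r / 4 * `|h| by rewrite mulr_gt0 ?divr_gt0 ?normr_gt0.
have slice k : `|k| = `|h| -> exists p, [/\ `|p| <= 1, `|p - p0| <= r / 4 &
    smooth_norm s (z + k) - r / 4 * `|h| <= (p (z + k) : R) - s * lur p].
  move=> kh; have [p p1 hp] := smooth_norm_adherent (z + k) s0 rh.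
  exists p; split => //; last exact: ltW.
  apply: dP => //; have := le_trans (ler_norm _) (smooth_norm_lipschitz z (z + k) s0).
  have := le_trans (ler_norm _) ((dual_norm_le1 p).2 p1 k).
  move: hp; rewrite linearD/= opprD addNKr normrN kh.
  move: (smooth_norm s z) (smooth_norm s (z + k)) (p k : R) (p z : R) (lur p).
  by move: (`|h|) hd; clear => *; lra.
have [p [p1 pp0 ph]] := slice h erefl.
have [q [q1 qp0 qh]] := slice (- h) (normrN h).
have := smooth_norm_ge z s0 p1; have := smooth_norm_ge z s0 q1.
have : (p h : R) - q h <= r / 2 * `|h|.
  apply: (le_trans (ler_norm _)); apply: (le_trans (dual_norm_ub (p - q) h)).
  rewrite ler_wpM2r// -[dual_norm _]/(`|p - q|).
  have -> : p - q = (p - p0) - (q - p0) by rewrite opprB addrA subrK.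
  apply: (le_trans (ler_normB _ _)); move: pp0 qp0.
  by move: (`|p - p0|) (`|q - p0|); clear => *; lra.
move: ph qh; rewrite !linearD !linearN/=.
move: (smooth_norm s z) (smooth_norm s (z + h)) (smooth_norm s (z - h)).
move: (p h : R) (p z : R) (lur p) (q h : R) (q z : R) (lur q) (`|h|).
by clear => *; lra.
Qed.

End SmoothNorm.

(** * Geometrically converging sequences *)

Section GeometricSequences.
Context {R : realType}.

Lemma near_half_lt (C e : R) : 0 < e -> \forall n \near \oo, C * 2^-1 ^+ n < e.
Proof.
move=> e0; have h : `|2^-1 : R| < 1 by rewrite gtr0_norm// invf_lt1// ltr1n.
exact: cvgr_lt (cvg_geometric C h) _ e0.
Qed.

Lemma half_lt (C e : R) : 0 < e -> exists n, C * 2^-1 ^+ n < e.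
Proof.
by move=> e0; have [n _ /(_ n (leqnn n))] := near_half_lt C e0; exists n.
Qed.

Lemma half_sum (V : normedModType R) (u : nat -> V) C :
  (forall i, `|u i.+1 - u i| <= C * 2^-1 ^+ i.+1) ->
  forall n m, (n <= m)%N -> `|u m - u n| <= C * (2^-1 ^+ n - 2^-1 ^+ m).
Proof.
move=> uC n m nm; rewrite -(subnKC nm).
elim: (m - n)%N => [|k IH]; first by rewrite addn0 !subrr normr0 mulr0.
rewrite addnS; have h := uC (n + k)%N.
have -> : u (n + k).+1 - u n = (u (n + k).+1 - u (n + k)%N) + (u (n + k)%N - u n).
  by rewrite addrA subrK.
apply: (le_trans (ler_normD _ _)); apply: (le_trans (lerD h IH)).
rewrite exprS; set a := _ ^+ (n + k); set b := _ ^+ n.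
have -> : C * (2^-1 * a) + C * (b - a) = C * (b - 2^-1 * a) by field.
exact: lexx.
Qed.

(** Completeness in the form used by the variational principle, stated for a [normedModType] so that
    it also covers closed subspaces. *)
Definition geometrically_complete (V : normedModType R) := forall (u : nat -> V) (C : R),
  (forall i, `|u i.+1 - u i| <= C * 2^-1 ^+ i.+1) -> exists z : V, u @ \oo --> z.

Lemma complete_geometrically (V : completeNormedModType R) :
  geometrically_complete V.
Proof.
move=> u C uC; exists (lim (u @ \oo)); apply: cauchy_cvg; apply: cauchy_exP => e e0.
have C0 : 0 <= C.
  by have := le_trans (normr_ge0 _) (uC 0%N); rewrite pmulr_lge0// exprn_gt0.
have [n nP] := half_lt C e0; exists (u n).
exists n => // m /= nm; rewrite -ball_normE/= distrC; apply: le_lt_trans nP.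
by apply: (le_trans (half_sum uC nm)); rewrite ler_wpM2l// gerBl exprn_ge0.
Qed.

End GeometricSequences.

(** * A variational principle with a prescribed class of perturbations *)

Section VariationalPrinciple.
Context {R : realType} {T : normedModType R}.
Implicit Types (x y z : T) (F G H : T -> R) (A : set T).

Definition lip (c : R) G := forall x y, `|G x - G y| <= c * `|x - y|.

Lemma lip_add c d G H : lip c G -> lip d H -> lip (c + d) (fun x => G x + H x).
Proof.
move=> Gc Hd x y; rewrite opprD addrACA mulrDl.
by apply: (le_trans (ler_normD _ _)); rewrite lerD.
Qed.

Lemma lip_scale_shift c a z G : 0 <= a -> lip c G ->
  lip (a * c) (fun x => a * G (x - z)).
Proof.
move=> a0 Gc x y; rewrite -mulrBr normrM ger0_norm// -mulrA ler_wpM2l//.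
by apply: (le_trans (Gc _ _)); rewrite opprB addrA subrK.
Qed.

Lemma lip_continuous c G : lip c G -> continuous G.
Proof.
move=> Gc x; apply/cvgrPdist_le => e e0.
have c1 : 0 < 1 + `|c| by rewrite ltr_wpDr.
near=> y; apply: (le_trans (Gc x y)).
apply: (@le_trans _ _ ((1 + `|c|) * `|x - y|)).
  by rewrite ler_wpM2r// (le_trans (ler_norm _))// lerDr.
rewrite -ler_pdivlMl// mulrC; near: y.
by apply: (@cvgr_dist_le _ _ _ _ _ id x) => //; rewrite divr_gt0.
Unshelve. all: by end_near. Qed.

Lemma norm_continuous_sub y : continuous (fun x => `|x - y|).
Proof.
apply: (@lip_continuous 1) => x x'; rewrite mul1r.
have -> : x - x' = (x - y) - (x' - y) by rewrite opprB addrA subrK.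
exact: ler_dist_dist.
Qed.

(** The last clause is closedness in the Lipschitz seminorm, for the sum of the perturbing series.
    The instances are the smooth convex functions, for subgradients, and all functions, for
    Ekeland's principle. *)
Definition perturbation_class (K : (T -> R) -> Prop) :=
  [/\ K (fun=> 0),
      forall G a z, K G -> 0 <= a -> K (fun x => a * G (x - z)),
      forall G H, K G -> K H -> K (fun x => G x + H x) &
      forall G, (forall e, 0 < e -> exists2 H, K H & lip e (fun x => G x - H x)) ->
        K G].

(** Sequential closedness of the epigraph of [F] over [A]: it merges closedness of the domain with
    lower semicontinuity, so that a real-valued [F] can represent an extended-valued function. *)
Definition epi_closed A F := forall (u : nat -> T) z (l : R),
  (forall i, A (u i)) -> u @ \oo --> z ->
  (forall e, 0 < e -> \forall i \near \oo, F (u i) <= l + e) -> A z /\ F z <= l.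

Lemma exists_almost_min A F M d y : A y -> (forall x, A x -> M <= F x) -> 0 < d ->
  exists2 z, A z & forall x, A x -> F z <= F x + d.
Proof.
move=> Ay FM d0.
have hi : has_inf [set F x | x in A].
  by split; [exists (F y), y|exists M => _ [x Ax <-]; exact: FM].
have [_ [z Az <-] zi] := inf_adherent d0 hi.
exists z => // x Ax; apply: (le_trans (ltW zi)); rewrite lerD2r.
by apply: ge_inf; [exact: hi.2|exists x].
Qed.

(* [N s] replaces the norm up to an additive error [s], so that [F] plus a
   series of translates of the [N s] attains its infimum. *)
Lemma variational_principle (K : (T -> R) -> Prop) (N : R -> T -> R) A F y
    (M eps rho : R) :
  geometrically_complete T -> perturbation_class K ->
  (forall s, 0 < s -> [/\ K (N s), lip 1 (N s) &
     forall x, `|x| - s <= N s x <= `|x|]) ->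
  epi_closed A F -> A y -> (forall x, A x -> M <= F x) ->
  0 < eps -> 0 < rho -> F y <= M + eps * rho / 32 ->
  exists z G, [/\ A z, `|z - y| < rho, K G, lip eps G &
    forall x, A x -> F z + G z <= F x + G x].
Proof.
move=> cT [K0 Ksc Kadd Klim] NP FA Ay FM e0 r0 Fy.
(* The Lipschitz constants [ep i] add up to [eps] and the step bounds [r i] to [rho / 2]. Since [eta
   i + eta i.+1 + ep i * s i <= ep i * r i], almost minimality of two consecutive points keeps them
   within [r i]. *)
pose ep i : R := eps * 2^-1 ^+ i.+1.
pose r i : R := rho * 2^-1 ^+ i.+2.
pose s i : R := r i / 2.
pose eta i : R := ep i * r i / 4.
have hp n : 0 < 2^-1 ^+ n :> R by rewrite exprn_gt0.
have ep0 i : 0 < ep i by rewrite mulr_gt0.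
have ri0 i : 0 < r i by rewrite mulr_gt0.
have s0 i : 0 < s i by rewrite divr_gt0.
have e1 := ltW e0; have r1 := ltW r0; have hp1 n := ltW (hp n).
have ep1 i := ltW (ep0 i); have ri1 i := ltW (ri0 i).
have half_le1 n : 2^-1 ^+ n <= 1 :> R by rewrite exprn_ile1// invf_le1// ler1n.
have eta0 i : 0 < eta i by rewrite divr_gt0// mulr_gt0.
(* Almost minimizers become a total function of perturbation and tolerance, with default [y], so
   that the iteration is a plain recursion. *)
have pick (Gd : (T -> R) * R) : exists z,
    (exists M', forall x, A x -> M' <= F x + Gd.1 x) -> 0 < Gd.2 ->
    A z /\ forall x, A x -> F z + Gd.1 z <= F x + Gd.1 x + Gd.2.
  have [[[M' FM'] d0]|h] := pselect
      ((exists M', forall x, A x -> M' <= F x + Gd.1 x) /\ 0 < Gd.2).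
    have [z Az zP] := exists_almost_min Ay FM' d0.
    by exists z.
  by exists y => h1 h2; exfalso; apply: h.
have {pick}[pk pkP] := choice pick.
pose nextG i (zG : T * (T -> R)) x := zG.2 x + ep i * N (s i) (x - zG.1).
pose st := fix st i := if i is j.+1
  then (pk (nextG j (st j), eta j.+1), nextG j (st j)) else (y, fun=> 0).
pose zz i := (st i).1; pose G i := (st i).2.
have GS i x : G i.+1 x = G i x + ep i * N (s i) (x - zz i) by [].
have KG i : K (G i).
  elim: i => [//|i IH]; apply: (Kadd _ (fun x => ep i * N (s i) (x - zz i))) => //.
  by apply: Ksc; [by have [] := NP _ (s0 i)|exact: ltW].
have Nlip i : lip (ep i) (fun x => ep i * N (s i) (x - zz i)).
  have [_ /lip_scale_shift h _] := NP _ (s0 i).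
  by have := h (ep i) (zz i) (ltW (ep0 i)); rewrite mulr1.
have Glb i x : - (eps * rho) * (1 - 2^-1 ^+ i) <= G i x.
  elim: i => [|i IH]; first by rewrite expr0 subrr mulr0.
  rewrite GS; have [_ _ /(_ (x - zz i))/andP[h _]] := NP _ (s0 i).
  have h1 : - s i <= N (s i) (x - zz i).
    by apply: le_trans h; rewrite lerDr.
  have := ler_wpM2l (ltW (ep0 i)) h1.
  have : ep i * s i <= eps * rho * 2^-1 ^+ i.+1.
    rewrite /ep mulrAC ler_wpM2r//// ler_wpM2l////.
    rewrite /s /r ler_pdivrMr// ler_wpM2l////.
    by rewrite (le_trans (half_le1 _))// ler1n.
  by move: IH; rewrite !exprS => *; lra.
have Flb i : exists M', forall x, A x -> M' <= F x + G i x.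
  exists (M - eps * rho) => x Ax.
  have := Glb i x; have := FM _ Ax.
  have : 0 <= eps * rho * 2^-1 ^+ i by rewrite !mulr_ge0// ltW.
  by move=> *; lra.
have zmin i : A (zz i) /\
    forall x, A x -> F (zz i) + G i (zz i) <= F x + G i x + eta i.
  case: i => [|i]; last exact: (pkP (G i.+1, eta i.+1) (Flb i.+1) (eta0 i.+1)).
  (* Here [eta 0 = eps * rho / 32]: the hypothesis on [y] is almost minimality of the starting
     point. *)
  split=> // x Ax; rewrite !addr0; apply: (le_trans Fy).
  apply: lerD; first exact: FM.
  by rewrite /eta /ep /r !exprS expr0; lra.
have zstep i : `|zz i.+1 - zz i| <= r i.
  have [Az1 h1] := zmin i.+1; have [Az h] := zmin i.
  have := h1 _ Az; have := h _ Az1; rewrite !GS subrr.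
  have [_ _ NPi] := NP _ (s0 i).
  have /andP[_ ] := NPi 0; rewrite normr0 => /(ler_wpM2l (ltW (ep0 i))).
  have /andP[+ _] := NPi (zz i.+1 - zz i) => /(ler_wpM2l (ltW (ep0 i))).
  have eta1 : eta i.+1 <= eta i.
    rewrite /eta ler_wpM2r// ler_pM// /ep /r ler_wpM2l//.
      by rewrite ler_iXn2l ?invf_lt1// ?ltr1n.
    by rewrite ler_iXn2l ?invf_lt1// ?ltr1n.
  move=> a1 a2 a3 a4.
  have : ep i * `|zz i.+1 - zz i| <= ep i * r i.
    by move: a1 a2 a3 a4 eta1; rewrite /s /eta; move=> *; lra.
  by rewrite ler_pM2l.
have zstep' i : `|zz i.+1 - zz i| <= (rho / 2) * 2^-1 ^+ i.+1.
  by apply: (le_trans (zstep i)); rewrite /r (exprS _ i.+1) mulrA.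
have [z zz_z] := cT _ _ zstep'.
have zzy i : `|zz i - y| <= rho / 2.
  apply: (le_trans (half_sum zstep' (leq0n i))).
  by rewrite expr0 ler_piMr ?divr_ge0// gerBl ltW.
have zy : `|z - y| <= rho / 2.
  have c : `|zz i - y| @[i --> \oo] --> `|z - y|.
    by apply: cvg_norm; apply: cvgB => //; exact: cvg_cst.
  by apply: (cvgr_to_le c); exact: nearW.
have Gstep x i : `|G i.+1 x - G i x| <= eps * (`|x - y| + rho) * 2^-1 ^+ i.+1.
  rewrite GS addrC addKr normrM gtr0_norm// /ep mulrAC ler_wpM2r//.
  rewrite ler_wpM2l//.
  have [_ _ /(_ (x - zz i))/andP[h1 h2]] := NP _ (s0 i).
  have : `|x - zz i| <= `|x - y| + rho / 2.
    have -> : x - zz i = (x - y) - (zz i - y) by rewrite opprB addrA subrK.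
    by apply: (le_trans (ler_normB _ _)); rewrite lerD2l.
  have : s i <= rho / 2.
    by rewrite /s ler_wpM2r// /r ler_piMr// half_le1.
  have := normr_ge0 (x - zz i).
  by move=> *; rewrite ler_norml; apply/andP; split; lra.
have [Gl GlP] := choice (fun x => @complete_geometrically _ R _ _ (Gstep x)).
have Glip n : lip (eps * 2^-1 ^+ n) (fun x => Gl x - G n x).
  move=> x x'.
  have c : `|(G m x - G n x) - (G m x' - G n x')| @[m --> \oo] -->
      `|(Gl x - G n x) - (Gl x' - G n x')|.
    by apply: cvg_norm; apply: cvgB; (apply: cvgB; last exact: cvg_cst); exact: GlP.
  apply: (cvgr_to_le c); near=> m.
  have nm : (n <= m)%N by near: m; exact: nbhs_infty_ge.
  apply: (@le_trans _ _ (eps * (2^-1 ^+ n - 2^-1 ^+ m) * `|x - x'|)); last first.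
    by rewrite ler_wpM2r// ler_wpM2l// gerBl ltW.
  rewrite -(subnKC nm); elim: (m - n)%N => [|k IH].
    by rewrite addn0 !subrr normr0 mulr0 mul0r.
  rewrite addnS !GS; have := Nlip (n + k)%N x x'.
  set a := ep _ * _; set b := ep _ * _ => ab.
  have -> : G (n + k)%N x + a - G n x - (G (n + k)%N x' + b - G n x') =
    (G (n + k)%N x - G n x - (G (n + k)%N x' - G n x')) + (a - b) by ring.
  apply: (le_trans (ler_normD _ _)); apply: (le_trans (lerD IH ab)).
  rewrite /ep -mulrDl ler_wpM2r// exprS.
  by set u := _ ^+ (n + k); set v := _ ^+ n; lra.
have tail x n : `|Gl x - G n x| <= eps * (`|x - y| + rho) * 2^-1 ^+ n.
  have c : `|G m x - G n x| @[m --> \oo] --> `|Gl x - G n x|.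
    by apply: cvg_norm; apply: cvgB; [exact: GlP|exact: cvg_cst].
  apply: (cvgr_to_le c); near=> m.
  have nm : (n <= m)%N by near: m; exact: nbhs_infty_ge.
  apply: (le_trans (@half_sum _ R (fun m => G m x) _ (Gstep x) _ _ nm)).
  by rewrite ler_wpM2l ?mulr_ge0 ?addr_ge0// gerBl ltW.
exists z, Gl.
have Gl0 : lip eps Gl.
  by move=> x x'; have := Glip 0%N x x'; rewrite expr0 mulr1 !subr0.
have Gzz : G i (zz i) @[i --> \oo] --> Gl z.
  have -> : (fun i => G i (zz i)) =
      (fun i => Gl (zz i) - (Gl (zz i) - G i (zz i))).
    by apply/funext => i; rewrite subKr.
  rewrite -[Gl z]subr0; apply: cvgB.
    by apply: continuous_cvg; [exact: (lip_continuous Gl0 (x := z))|exact: zz_z].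
  apply/cvgrPdist_le => d d0.
  have := near_half_lt (eps * (rho / 2 + rho)) d0; apply: filterS => i hi.
  rewrite sub0r normrN; apply: le_trans (tail _ _) (le_trans _ (ltW hi)).
  by rewrite ler_wpM2r// ler_wpM2l// lerD2r.
(* Almost minimality of [zz i] passes to the limit: [F (zz i)] lies below a sequence tending to the
   right-hand side, and [epi_closed] applies. *)
have Fz x : A x -> A z /\ F z <= F x + Gl x - Gl z.
  move=> Ax; apply: (FA zz) => // [i|e' e'0]; first exact: (zmin i).1.
  have c : F x + G i x + eta i - G i (zz i) @[i --> \oo] -->
      F x + Gl x + 0 - Gl z.
    apply: cvgB; [apply: cvgD; first by apply: cvgD; [exact: cvg_cst|exact: GlP]|].
      apply/cvgrPdist_le => d d0.
      have := near_half_lt (eps * rho) d0; apply: filterS => i hi.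
      rewrite sub0r normrN gtr0_norm//; apply: le_trans (ltW hi).
      rewrite /eta /ep /r.
      have := half_le1 i.
      have : 0 < eps * rho * 2^-1 ^+ i by rewrite !mulr_gt0.
      rewrite !exprS => h1 /(ler_wpM2l (ltW h1)); lra.
    exact: Gzz.
  have c' : F x + G i x + eta i - G i (zz i) @[i --> \oo] --> F x + Gl x - Gl z.
    by move: c; rewrite addr0.
  have : F x + Gl x - Gl z < F x + Gl x - Gl z + e' by rewrite ltrDl.
  move=> lt; apply: filterS (cvgr_le _ c' _ lt) => i; apply: le_trans.
  by have [_ /(_ x Ax)] := zmin i; rewrite lerBrDr.
have [Az _] := Fz _ Ay.
split=> //.
- by apply: (le_lt_trans zy); rewrite ltr_pdivrMr// ltr_pMr// ltr1n.
- apply: Klim => d d0; have [n nd] := half_lt eps d0; exists (G n) => // x x'.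
  by apply: (le_trans (Glip n x x')); rewrite ler_wpM2r// ltW.
- by move=> x Ax; have [_ h] := Fz _ Ax; rewrite -lerBrDr.
Unshelve. all: by end_near. Qed.

End VariationalPrinciple.

(** * Smooth convex functions as a perturbation class *)

Section SmoothConvexClass.
Context {R : realType} {T : normedModType R}.
Implicit Types (x y z : T) (G H : T -> R).

Lemma perturbation_classT : perturbation_class (fun _ : T -> R => True).
Proof. by split. Qed.

(** The convexity inequality at [m] involves only the differences [G m - G x] and [G m - G y], so an
    approximation in the Lipschitz seminorm controls it. *)
Lemma convex_lim G : (forall e, 0 < e ->
    exists2 H, convex_on_space H & lip e (fun x => G x - H x)) ->
  convex_on_space G.
Proof.
move=> GH x y t t01; apply/ler_addgt0Pr => e e0.
set m := t *: x + (1 - t) *: y.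
have b0 : 0 < 1 + `|m - x| + `|m - y| by rewrite -addrA ltr_wpDr ?addr_ge0.
have [H cH GHe] := GH _ (divr_gt0 e0 b0).
have := cH x y t t01; rewrite -/m; have := GHe m x; have := GHe m y.
rewrite !ler_norml => /andP[_ h1] /andP[_ h2] h3.
have : e / (1 + `|m - x| + `|m - y|) * `|m - x| +
    e / (1 + `|m - x| + `|m - y|) * `|m - y| <= e.
  rewrite -mulrDr -mulrA ger_pMr// mulrC ler_pdivrMr// mul1r.
  by rewrite lerD2r lerDr.
move: h1 h2; set u := _ * `|m - x|; set v := _ * `|m - y|.
have u0 : 0 <= u by rewrite mulr_ge0// divr_ge0// ltW.
have v0 : 0 <= v by rewrite mulr_ge0// divr_ge0// ltW.
move: t01 h3 u0 v0 => /andP[t0 t1].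
move: (G m) (G x) (G y) (H m) (H x) (H y) u v; clear -t0 t1.
move=> gm gx gy hm hx hy u v h3 u0 v0 hv hu uve.
have s0 : 0 <= 1 - t by rewrite subr_ge0.
have := ler_wpM2l t0 hu; have := ler_wpM2l s0 hv.
have := ler_wpM2r u0 t1; have := ler_wpM2r v0 t0; move: h3 uve u0 v0; clear.
by move=> *; lra.
Qed.

Lemma smooth_convex_class : perturbation_class (@smooth_convex R T).
Proof.
split.
- split=> [x y t _|z e e0]; first by rewrite !mulr0 addr0.
  by exists 1 => // h _; rewrite mulr0 addr0 subr0 mulr_ge0// ltW.
- move=> G a z [cG sG] a0; split=> [x y t t01|w e e0].
    have -> : t *: x + (1 - t) *: y - z = t *: (x - z) + (1 - t) *: (y - z).
      by rewrite !scalerBr addrACA -opprD -scalerDl (addrC t) subrK scale1r.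
    have := ler_wpM2l a0 (cG (x - z) (y - z) t t01).
    by rewrite mulrDr !(mulrCA a).
  have a1 : 0 < 1 + a by rewrite ltr_wpDr.
  have [d d0 dP] := sG (w - z) _ (divr_gt0 e0 a1).
  exists d => // h hd; rewrite !(addrAC w _ (- z)).
  have -> : 2 * (a * G (w - z)) = a * (2 * G (w - z)) by rewrite mulrCA.
  rewrite -mulrDr -mulrBr; apply: (le_trans (ler_wpM2l a0 (dP h hd))).
  rewrite mulrA ler_wpM2r// mulrCA ger_pMr// ler_pdivrMr// mul1r.
  by rewrite lerDr.
- move=> G H [cG sG] [cH sH]; split=> [x y t t01|z e e0].
    by have := lerD (cG x y t t01) (cH x y t t01); rewrite !mulrDr addrACA.
  have e2 : 0 < e / 2 by rewrite divr_gt0.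
  have [d1 d10 h1] := sG z _ e2; have [d2 d20 h2] := sH z _ e2.
  exists (Order.min d1 d2); first by rewrite lt_min d10.
  move=> h; rewrite lt_min => /andP[/h1 k1 /h2 k2].
  have := lerD k1 k2; rewrite -mulrDl -splitr; apply: le_trans.
  by rewrite mulrDr opprD [leRHS]addrACA (addrACA (G (z + h))).
- move=> G GH; split=> [|z e e0].
    by apply: convex_lim => e e0; have [H [cH _] HG] := GH e e0; exists H.
  have e4 : 0 < e / 4 by rewrite divr_gt0.
  have [H [_ sH] HG] := GH _ e4.
  have [d d0 dP] := sH z _ e4; exists d => // h /dP.
  have := HG (z + h) z; have := HG (z - h) z.
  have -> : z + h - z = h by rewrite addrAC subrr add0r.
  have -> : z - h - z = - h by rewrite addrAC subrr add0r.
  rewrite normrN.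
  rewrite !ler_norml => /andP[_ h1] /andP[_ h2] h3.
  have : 0 <= e / 4 * `|h| by rewrite mulr_ge0// ltW.
  move: h1 h2 h3; move: (G (z + h)) (G (z - h)) (G z) (H (z + h)) (H (z - h)).
  by move: (H z) (`|h|); clear => *; lra.
Qed.

End SmoothConvexClass.

(** * Cones of constraints coming from a convex function *)

Section ConvexCone.
Context {R : realType} {X : normedModType R}.

Lemma cone_sum (B : X -> R -> Prop) N (a : nat -> R) (h : nat -> X) (t : nat -> R) :
  (forall i, 0 <= a i) -> (forall i, (i < N)%N -> B (h i) (t i)) ->
  cone B (\sum_(i < N) a i *: h i) (\sum_(i < N) a i * t i).
Proof.
move=> a0; elim: N => [|N IH] Bht; first by rewrite !big_ord0; exact: cone0.
rewrite !big_ord_recr/= addrC [in X in cone _ _ X]addrC.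
by apply: coneD; [exact: a0|exact: Bht|apply: IH => i iN; apply: Bht; rewrite ltnS ltnW].
Qed.

Lemma coneE (B : X -> R -> Prop) h t : cone B h t ->
  exists N (a : nat -> R) (hs : nat -> X) (ts : nat -> R),
  [/\ forall i, 0 <= a i, forall i, (i < N)%N -> B (hs i) (ts i),
      h = \sum_(i < N) a i *: hs i & t = \sum_(i < N) a i * ts i].
Proof.
elim=> [|a h' t' k s a0 Bh _ [N [as_ [hs [ts [as0 Bs -> ->]]]]]].
  by exists 0%N, (fun=> 0), (fun=> 0), (fun=> 0); split; rewrite ?big_ord0.
exists N.+1, (fun i => if i == N then a else as_ i).
exists (fun i => if i == N then h' else hs i).
exists (fun i => if i == N then t' else ts i); split.
- by move=> i; case: ifP.
- move=> i; rewrite ltnS leq_eqVlt; case: ifPn => //= _; exact: Bs.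
- rewrite big_ord_recr/= eqxx addrC; congr (_ + _); apply: eq_bigr => i _.
  by rewrite ltn_eqF.
- rewrite big_ord_recr/= eqxx addrC; congr (_ + _); apply: eq_bigr => i _.
  by rewrite ltn_eqF.
Qed.

(** By convexity each [(h, t)] in the cone satisfies [G (z - u h) - G z <= u t] for some [u > 0];
    the Lipschitz bound gives [- c u |h|] below the left-hand side. *)
Lemma convex_cone_lb (G : X -> R) c z h t : convex_on_space G -> lip c G ->
  cone (fun k s => G (z - k) - G z <= s) h t -> 0 <= t + c * `|h|.
Proof.
move=> cG lG ct.
suff [u u0 hu] : exists2 u : R, 0 < u & G (z - u *: h) - G z <= u * t.
  have := lG (z - u *: h) z; rewrite addrAC subrr add0r normrN normrZ gtr0_norm//.
  rewrite ler_norml => /andP[h1 _]; rewrite -(pmulr_rge0 _ u0).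
  move: hu h1; move: (G z) (G (z - u *: h)) (`|h|); clear => *.
  by rewrite mulrDr; lra.
elim: ct => {h t} [|a h t k s a0 hB _ [v v0 IH]].
  by exists 1 => //; rewrite scaler0 subr0 subrr mulr0.
have [->|a_neq0] := eqVneq a 0.
  by exists v => //; rewrite scale0r mul0r !add0r.
have ap : 0 < a by rewrite lt0r a_neq0.
(* [z - u (a h + k)] is a convex combination of [z - h] and [z - v k]. *)
have av0 : 0 < 1 + a * v by rewrite addr_gt0// mulr_gt0.
exists (v / (1 + a * v)); first by rewrite divr_gt0.
set u := v / _; pose w := a * u.
have w01 : 0 <= w <= 1.
  rewrite /w /u mulrA divr_ge0 ?mulr_ge0 ?(ltW v0) ?(ltW av0)//= ler_pdivrMr// mul1r.
  by rewrite lerDr.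
have uE : u = (1 - w) * v by rewrite /w /u; field; rewrite gt_eqF.
have zE : z - u *: (a *: h + k) = w *: (z - h) + (1 - w) *: (z - v *: k).
  rewrite !scalerBr addrACA -scalerDl (addrC w) subrK scale1r -opprD scalerA.
  by rewrite -uE scalerDr scalerA mulrC.
rewrite zE; have := cG (z - h) (z - v *: k) _ w01.
have uw : u * (a * t + s) = w * t + (1 - w) * (v * s).
  by rewrite mulrDr mulrA (mulrC u a) -/w uE mulrA.
move: w01 hB IH => /andP[w0 w1] /(ler_wpM2l w0) h1.
have w2 : 0 <= 1 - w by rewrite subr_ge0.
move=> /(ler_wpM2l w2) h2; rewrite uw; move: h1 h2.
clearbody w; move: (G (z - h)) (G (z - v *: k)) (G z) (G _) (v * s).
by clear => *; lra.
Qed.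

End ConvexCone.

(** * Separable subspaces that contain prescribed witnesses *)

Section SeparableWitnesses.
Context {R : realType} {X : normedModType R}.
Implicit Types (C : set X) (x y : X).

Lemma closureP_norm C x : closure C x <->
  forall e : R, 0 < e -> exists2 y, C y & `|x - y| < e.
Proof.
split=> [Cx e e0|h B /nbhs_ballP[e /= e0 eB]].
  have [y [Cy xy]] := Cx _ (nbhsx_ballx x e e0).
  by exists y => //; move: xy; rewrite -ball_normE.
have [y Cy xy] := h _ e0; exists y; split=> //; apply: eB.
by rewrite -ball_normE.
Qed.

Lemma rat_dense (a e : R) : 0 < e -> exists q : rat, `|a - ratr q| < e.
Proof.
move=> e0; have [|q] := @rat_in_itvoo R (a - e) (a + e).
  by lra.
by rewrite in_itv/= -ltr_distlC; exists q.
Qed.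

(** Rational coefficients allow [C] to be countable; their density gives real combinations in the
    closure. *)
Lemma closure_submod_closed C x0 : C x0 ->
  (forall (q : rat) x y, C x -> C y -> C (ratr q *: x + y)) ->
  submod_closed [pred x : X | `[< closure C x >]].
Proof.
move=> Cx0 CD; split.
  rewrite inE; apply: subset_closure; have := CD (-1) x0 x0 Cx0 Cx0.
  by rewrite rmorphN1 scaleN1r addNr.
move=> a x y; rewrite !inE => /closureP_norm Cx /closureP_norm Cy.
apply/closureP_norm => e e0.
have e3 : 0 < e / 3 by rewrite divr_gt0.
have x1 : 0 < 1 + `|x| by rewrite ltr_wpDr.
have [q aq] := rat_dense a (divr_gt0 e3 x1).
have q1 : 0 < 1 + `|ratr q : R| by rewrite ltr_wpDr.
have [x' Cx' xx'] := Cx _ (divr_gt0 e3 q1).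
have [y' Cy' yy'] := Cy _ e3.
exists (ratr q *: x' + y'); first exact: CD.
have -> : a *: x + y - (ratr q *: x' + y') =
    (a - ratr q) *: x + (ratr q *: (x - x') + (y - y')).
  rewrite scalerBl scalerBr opprD addrACA -!addrA; congr (_ + _).
  by rewrite addrA addKr.
have h1 : `|(a - ratr q) *: x| <= e / 3.
  rewrite normrZ; move: aq; rewrite ltr_pdivlMr// => /ltW; apply: le_trans.
  by rewrite ler_wpM2l// lerDr.
have h2 : `|ratr q *: (x - x')| <= e / 3.
  rewrite normrZ mulrC; move: xx'; rewrite ltr_pdivlMr// => /ltW; apply: le_trans.
  by rewrite ler_wpM2l// lerDr.
apply: (le_lt_trans (ler_normD _ _)).
have := ler_normD (ratr q *: (x - x')) (y - y').
by move: h1 h2 yy'; move: (`|_|) (`|_|) (`|_|) (`|_|) => *; lra.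
Qed.

Lemma separable_submod (S : submodClosed X) C : countable C ->
  (forall x, (x \in S) <-> closure C x) -> separable (submod S).
Proof.
move=> cC SC; exists [set s : submod S | C (submod_val s)].
  have [g gi] := countable_injP _ cC; apply/countable_injP.
  exists (fun s => g (submod_val s)) => s t /set_mem Cs /set_mem Ct /gi st.
  by apply: val_inj; apply: st; rewrite inE.
move=> O [s Os] oO.
have /nbhs_ballP[e /= e0 eO] : nbhs s O by exact: open_nbhs_nbhs.
have /SC/closureP_norm/(_ e e0)[y Cy sy] : submod_val s \in S by case: (s).
have Sy : y \in S by apply/SC; exact: subset_closure.
exists (Submod Sy); split=> //; apply: eO; rewrite -ball_normE/=.
exact: sy.
Qed.

Lemma countableU (U : Type) (D E : set U) :
  countable D -> countable E -> countable (D `|` E).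
Proof.
move=> cD cE; rewrite -bigcup2E; apply: bigcup_countable; first exact: countableP.
by case=> [|[|n]] _ //=; exact: countable0.
Qed.

Lemma countable_image (U W : Type) (g : U -> W) (D : set U) :
  countable D -> countable (g @` D).
Proof. exact: sub_countable (card_image_le _ _). Qed.

(* Elementary-submodel argument: the witnesses of countably many open
   conditions are selected inside one separable subspace. *)
Lemma separable_witnesses (A : countType) (V : A -> X -> (nat -> X) -> Prop) x0 :
  (forall a ws, open [set x | V a x ws]) ->
  exists S : submodClosed X, [/\ x0 \in S, closed [set x | x \in S],
    separable (submod S) & forall a x, x \in S -> (exists ws, V a x ws) ->
      exists2 ws, V a x ws & forall i, ws i \in S].
Proof.
move=> oV; pose r (k : nat) : R := k.+1%:R^-1.
have r0 k : 0 < r k by rewrite invr_gt0.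
(* The selected [ws] works on the whole ball of radius [r k] about the given point, if any witness
   does. *)
have selex (p : A * X * nat) : exists ws, (exists ws',
    forall x, `|p.1.2 - x| < r p.2 -> V p.1.1 x ws') ->
    forall x, `|p.1.2 - x| < r p.2 -> V p.1.1 x ws.
  by have [[ws h]|h] := pselect (exists ws',
    forall x, `|p.1.2 - x| < r p.2 -> V p.1.1 x ws'); [exists ws|exists (fun=> 0)].
have [sel selP] := choice selex.
pose lin (p : rat * X * X) := ratr p.1.1 *: p.1.2 + p.2.
pose step C := C `|` (lin @` ([set: rat] `*` C `*` C) `|`
  (fun p : A * X * nat * nat => sel p.1 p.2) @`
    ([set: A] `*` C `*` [set: nat] `*` [set: nat])).
pose Cn n := iter n step [set x0].
pose C := \bigcup_n Cn n.
have cstep D : countable D -> countable (step D).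
  move=> cD; apply: countableU => //; apply: countableU; apply: countable_image;
    by repeat apply: countableX => //; exact: countableP.
have cC : countable C.
  apply: bigcup_countable; first exact: countableP.
  by move=> n _; elim: n => [|n IH]; [exact: countable1|exact: cstep].
have CnS n m : (n <= m)%N -> Cn n `<=` Cn m.
  move=> nm; rewrite -(subnKC nm); elim: (m - n)%N => [|k IH]; first by rewrite addn0.
  by rewrite addnS => x Cx; left; exact: IH.
have Cx0 : C x0 by exists 0%N.
have CD (q : rat) x y : C x -> C y -> C (ratr q *: x + y).
  move=> [n _ Cx] [m _ Cy]; exists (maxn n m).+1 => //; right; left.
  exists (q, x, y) => //; split=> /=; first split => //=.
    exact: (CnS n _ (leq_maxl _ _)).
  exact: (CnS m _ (leq_maxr _ _)).
have Csel a x k i : C x -> C (sel (a, x, k) i).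
  by move=> [n _ Cx]; exists n.+1 => //; right; right; exists (a, x, k, i).
pose P : {pred X} := [pred x : X | `[< closure C x >]].
pose m := GRing.isSubmodClosed.Build R X P (closure_submod_closed Cx0 CD).
pose S : submodClosed X := HB.pack P m.
have SE x : (x \in S) <-> closure C x by split=> [/asboolP|/asboolP].
exists S; split.
- by apply/SE; exact: subset_closure.
- by rewrite (_ : [set x | x \in S] = closure C); [exact: closed_closure|
    apply/seteqP; split=> x /SE].
- exact: separable_submod SE.
- move=> a x /SE Sx [ws Vws].
  have : nbhs x [set x | V a x ws] by apply: open_nbhs_nbhs; split.
  move=> /nbhs_ballP[e /= e0 eV].
  (* For [x'] in [C] within [r k] of [x], the ball of radius [r k] about [x'] contains [x] and lies
     in the ball of radius [e] about [x]; so the witness selected at [x'] exists and is valid at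
     [x]. *)
  have [k ke] : exists k, r k < e / 2.
    have e2 : 0 < e / 2 by rewrite divr_gt0.
    by have [k _ /(_ k (leqnn k))] := cvgr_lt _ (@cvg_harmonic R) _ e2; exists k.
  have /closureP_norm/(_ _ (r0 k))[x' Cx' xx'] := Sx.
  have selx' : forall z, `|x' - z| < r k -> V a z (sel (a, x', k)).
    apply: (selP (a, x', k)); exists ws => z /= x'z; apply: eV.
    rewrite -ball_normE/= -(subrKA x') (le_lt_trans (ler_normD _ _))//.
    by move: xx' x'z ke; move: (`|_|) (`|_|) (r k) => *; lra.
  exists (sel (a, x', k)); first by apply: selx'; rewrite distrC.
  by move=> i; apply/SE; apply: subset_closure; exact: Csel.
Qed.

End SeparableWitnesses.

(** * Stability of closed epigraphs *)

Section EpiClosed.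
Context {R : realType}.

Lemma epi_closed_comp (T X : normedModType R) (g : T -> X) A F :
  continuous g -> epi_closed A F -> epi_closed (g @^-1` A) (F \o g).
Proof.
move=> cg FA u z l Au uz Fu; apply: (FA (g \o u)) => //.
by apply: continuous_cvg; [exact: cg|exact: uz].
Qed.

Lemma epi_closedI (T : normedModType R) (A C : set T) F :
  closed C -> epi_closed A F -> epi_closed (A `&` C) F.
Proof.
move=> cC FA u z l AC uz Fu; have [|Az Fz] := FA u z l _ uz Fu.
  by move=> i; exact: (AC i).1.
split=> //; split=> //; apply: (closed_cvg _ cC _ _ uz).
by apply: nearW => i; exact: (AC i).2.
Qed.

Lemma epi_closedD (T : normedModType R) (A : set T) F (G : T -> R) :
  continuous G -> epi_closed A F -> epi_closed A (fun x => F x + G x).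
Proof.
move=> cG FA u z l Au uz Fu.
have Gu : G (u i) @[i --> \oo] --> G z.
  by apply: continuous_cvg; [exact: cG|exact: uz].
have [||Az Fz] := FA u z (l - G z) _ uz; [by []|move=> e e0|]; last by split=> //; lra.
have e2 : 0 < e / 2 by rewrite divr_gt0.
have lt : G z - e / 2 < G z by lra.
near=> i; have : F (u i) + G (u i) <= l + e / 2 by near: i; exact: Fu.
have : G z - e / 2 <= G (u i) by near: i; exact: cvgr_ge _ Gu _ lt.
by move=> *; lra.
Unshelve. all: by end_near. Qed.

End EpiClosed.

(** * Frechet subgradients and finite certificates against them *)

Lemma cvg_sum_ord (R : realType) (V : normedModType R) (W : Type)
    (Fi : set_system W) (FF : Filter Fi) N (g : 'I_N -> W -> V) (l : 'I_N -> V) :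
  (forall i, g i x @[x --> Fi] --> l i) ->
  \sum_(i < N) g i x @[x --> Fi] --> \sum_(i < N) l i.
Proof. by move=> gl; apply: cvg_big => [|i _]; [exact: add_continuous|exact: gl]. Qed.

Section Violation.
Context {R : realType} {X : normedModType R}.
Implicit Types (A : set X) (F : X -> R) (x y z w h : X) (v : dual X).

(** The Frechet subgradients of the function equal to [F] on [A] and to [+oo] elsewhere. *)
Definition frechet_subgrad A F z v := A z /\ forall e, 0 < e ->
  exists2 d, 0 < d &
    forall w, A w -> `|w - z| < d -> F z + (v (w - z) : R) - e * `|w - z| <= F w.

(* A finite certificate [ws] that no [v] with [|v h| <= c |h|] satisfies
   [v (w - x) <= F w - F x + |w - x| / (n + 1)] for [|w - x| < 1 / (k + 1)],
   with [(n, k)] ranging over the list [a.2] and the rational [a.1 < F x] as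
   a substitute for [F x], which need not be continuous in [x]. *)
Definition violation A F (c : R) (a : rat * seq (nat * nat)) x (ws : nat -> X) :=
  exists lam : nat -> R, [/\ forall i, 0 <= lam i,
    forall i, (i < size a.2)%N ->
      A (ws i) /\ `|ws i - x| < (nth (0, 0)%N a.2 i).2.+1%:R^-1 &
    \sum_(i < size a.2) lam i * (F (ws i) - ratr a.1
       + `|ws i - x| / (nth (0, 0)%N a.2 i).1.+1%:R)
    + c * `|\sum_(i < size a.2) lam i *: (ws i - x)| < 0].

(** For fixed [lam] the point [x] enters only through norms, in finitely many strict
    inequalities. *)
Lemma violation_open A F c a ws : open [set x | violation A F c a x ws].
Proof.
rewrite openE => x /= [lam [lam0 Aws E0]].
have dist w : `|w - x'| @[x' --> x] --> `|w - x|.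
  by apply: cvg_norm; apply: cvgB => //; exact: cvg_cst.
pose D i x' := `|ws i - x'| < (nth (0, 0)%N a.2 i).2.+1%:R^-1.
have nearD : \forall x' \near x, forall i : 'I_(size a.2), D i x'.
  apply: filter_forall => i; apply: (cvgr_lt _ (dist (ws i))).
  exact: (Aws _ (ltn_ord i)).2.
pose E x' := \sum_(i < size a.2) lam i * (F (ws i) - ratr a.1
    + `|ws i - x'| / (nth (0, 0)%N a.2 i).1.+1%:R)
    + c * `|\sum_(i < size a.2) lam i *: (ws i - x')|.
have cE : E x' @[x' --> x] --> E x.
  apply: cvgD.
    apply: cvg_sum_ord => i; apply: cvgM; first exact: cvg_cst.
    apply: cvgD; first exact: cvg_cst.
    by apply: cvgM; [exact: dist|exact: cvg_cst].
  apply: cvgM; first exact: cvg_cst.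
  apply: cvg_norm; apply: cvg_sum_ord => i; apply: cvgZr.
  by apply: cvgB => //; exact: cvg_cst.
have nearE : \forall x' \near x, E x' < 0 by exact: (cvgr_lt _ cE).
apply: filterS2 nearD nearE => x' Dx' Ex'; exists lam; split=> // i ia.
by split; [exact: (Aws _ ia).1|exact: (Dx' (Ordinal ia))].
Qed.

(** Here [k n] gives the radius on which the subgradient inequality with error [1 / (n + 1)] is
    imposed. If [sandwich] failed, a finite conic combination of these constraints would be
    contradictory, with room to replace [F z] by a smaller rational: a certificate. *)
Lemma no_violation_subgrad A F c z (k : nat -> nat) : 0 <= c -> A z ->
  (forall a ws, ratr a.1 < F z ->
    (forall i, (nth (0, 0)%N a.2 i).2 = k (nth (0, 0)%N a.2 i).1 \/
       (size a.2 <= i)%N) -> ~ violation A F c a z ws) ->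
  exists v, (forall h, `|v h| <= c * `|h|) /\ frechet_subgrad A F z v.
Proof.
move=> c0 Az nov.
pose B h (t : R) := exists n w, [/\ A w, `|w - z| < (k n).+1%:R^-1, h = w - z &
  t = F w - F z + `|w - z| / n.+1%:R].
have [h t ct|v [vc vB]] := @sandwich R X B c c0; last first.
  exists v; split=> //; split=> // e e0.
  have [n _ /(_ n (leqnn n)) ne] := cvgr_lt _ (@cvg_harmonic R) _ e0.
  exists (k n).+1%:R^-1; first by rewrite invr_gt0.
  move=> w Aw wz; have /vB : B (w - z) (F w - F z + `|w - z| / n.+1%:R).
    by exists n, w.
  have := ler_wpM2r (normr_ge0 (w - z)) (ltW ne); rewrite /harmonic/=.
  rewrite [X in X <= _ -> _]mulrC.
  move: (`|w - z| / _) (v (w - z) : R) (e * _) (F z) (F w); clear => *; lra.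
rewrite leNgt; apply/negP => tc.
have [N [lam [hs [ts [lam0 Bi hE tE]]]]] := coneE ct.
have ex i : exists nw : nat * X, (i < N)%N ->
    [/\ A nw.2, `|nw.2 - z| < (k nw.1).+1%:R^-1, hs i = nw.2 - z &
     ts i = F nw.2 - F z + `|nw.2 - z| / nw.1.+1%:R].
  have [iN|iN] := boolP (i < N)%N; last by exists (0%N, 0).
  by have [n [w nw]] := Bi _ iN; exists (n, w).
have [nw nwP] := choice ex.
pose l := mkseq (fun i => ((nw i).1, k (nw i).1)) N.
have L0 : 0 <= \sum_(i < N) lam i by exact: sumr_ge0.
have L1 : 0 < 1 + \sum_(i < N) lam i by rewrite ltr_wpDr.
have g0 : 0 < - (t + c * `|h|) by rewrite oppr_gt0.
(* So close to [F z] that the total change, weighted by [lam], stays below the gap; the added 1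
   keeps the denominator positive. *)
have [|q] := @rat_in_itvoo R (F z - - (t + c * `|h|) / (1 + \sum_(i < N) lam i)) (F z).
  by rewrite gtrDl oppr_lt0 divr_gt0.
rewrite in_itv/= => /andP[q1 q2].
have sl : size l = N by rewrite size_mkseq.
have nl i : (i < N)%N -> nth (0, 0)%N l i = ((nw i).1, k (nw i).1).
  by move=> iN; rewrite nth_mkseq.
apply: (nov (q, l) (fun i => (nw i).2)) => //=.
  move=> i; rewrite sl; have [iN|] := ltnP i N; last by right.
  by left; rewrite nl.
exists lam; split=> //=.
  move=> i; rewrite sl => iN; have [Aw wz _ _] := nwP _ iN.
  by rewrite nl.
rewrite sl.
have -> : \sum_(i < N) lam i *: ((nw i).2 - z) = h.
  rewrite hE; apply: eq_bigr => i _; congr (_ *: _).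
  by have [_ _ ->] := nwP _ (ltn_ord i).
rewrite (eq_bigr (fun i : 'I_N => lam i * ts i + lam i * (F z - ratr q))); last first.
  move=> i _; rewrite nl//=; have [_ _ _ ->] := nwP _ (ltn_ord i).
  by rewrite -mulrDr; congr (_ * _); ring.
rewrite big_split/= -tE -mulr_suml.
have q3 : (1 + \sum_(i < N) lam i) * (F z - ratr q) < - (t + c * `|h|).
  by rewrite mulrC -ltr_pdivlMr// ltrBlDr -ltrBlDl.
have q4 : (\sum_(i < N) lam i) * (F z - ratr q) <
    (1 + \sum_(i < N) lam i) * (F z - ratr q).
  by rewrite ltr_pM2r ?subr_gt0// ltrDr.
by rewrite addrAC -ltrBrDl sub0r; exact: lt_trans q4 q3.
Qed.

End Violation.

(** * Subgradients from slope bounds in Asplund spaces *)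

Section AsplundSubgradient.
Context {R : realType}.

Lemma submod_valB (X : normedModType R) (S : submodClosed X) (s t : submod S) :
  submod_val (s - t) = submod_val s - submod_val t.
Proof. by []. Qed.

Lemma submod_val_continuous (X : normedModType R) (S : submodClosed X) :
  continuous (@submod_val R X S).
Proof.
move=> s B /nbhs_ballP[e /= e0 eB]; apply/nbhs_ballP; exists e => //= t st.
by apply: eB; move: st; rewrite -!ball_normE.
Qed.

Lemma submod_complete (X : completeNormedModType R) (S : submodClosed X) :
  closed [set x | x \in S] -> geometrically_complete (submod S).
Proof.
move=> cS u C uC.
have [i|z uz] := @complete_geometrically R X (fun i => submod_val (u i)) C.
  by have := uC i; rewrite submod_normE submod_valB.
have Sz : z \in S.
  apply: (closed_cvg _ cS _ _ uz); apply: nearW => i.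
  by case: (u i).
exists (Submod Sz); apply/cvgrPdist_le => e e0.
have /cvgrPdist_le/(_ e e0) := uz; apply: filterS => i.
by rewrite submod_normE submod_valB.
Qed.

Lemma separable_dense_seq (V : normedModType R) : separable V ->
  exists e : nat -> V, forall p (r : R), 0 < r -> exists n, `|p - e n| < r.
Proof.
move=> [D /countable_injP[g gi] dD].
have ex n : exists d, forall d', D d' -> g d' = n -> d' = d.
  have [[d [Dd gd]]|h] := pselect (exists d, D d /\ g d = n).
    by exists d => d' Dd' gd'; apply: gi; rewrite ?inE// gd gd'.
  by exists 0 => d' Dd' gd'; exfalso; apply: h; exists d'.
have [e eP] := choice ex; exists e => p r r0.
have [||d [pd Dd]] := dD (ball p r).
- by exists p; exact: ballxx.
- exact: ball_open.
by exists (g d); rewrite -(eP _ _ Dd erefl); move: pd; rewrite -ball_normE.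
Qed.

(* By smoothness [F w - F z >= G z - G w >= G (2 z - w) - G z - o(|w - z|)], and
   convexity of [G] allows summing these inequalities up. *)
Lemma smooth_min_no_violation (T : normedModType R) A (F G : T -> R) z c a ws
    (k : nat -> nat) r : smooth_convex G -> lip c G ->
  (forall w, A w -> `|w - z| < r -> F z + G z <= F w + G w) ->
  (forall n h, `|h| < (k n).+1%:R^-1 -> `|h| < r /\
     G (z + h) + G (z - h) - 2 * G z <= n.+1%:R^-1 * `|h|) ->
  ratr a.1 < F z ->
  (forall i, (nth (0, 0)%N a.2 i).2 = k (nth (0, 0)%N a.2 i).1 \/
     (size a.2 <= i)%N) -> ~ violation A F c a z ws.
Proof.
move=> [cG _] lG minz kP az ak [lam [lam0 Aws]]; apply/negP; rewrite -leNgt.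
apply: (convex_cone_lb (z := z) cG lG).
apply: (cone_sum (h := fun i => ws i - z)
  (t := fun i => F (ws i) - ratr a.1 + `|ws i - z| / (nth (0, 0)%N a.2 i).1.+1%:R)
  lam0) => i ia.
have [Aw wz] := Aws _ ia; have [ki|] := ak i; last by rewrite leqNgt ia.
move: wz; rewrite ki => /kP[wz]; rewrite [z + _]addrC subrK (mulrC _^-1) => kG.
have := minz _ Aw wz; move: az kG.
move: (ratr _) (_ / _) (G (z - _)) (G z) (G (ws i)) (F z) (F (ws i)).
by clear => *; lra.
Qed.

(** On [S] the slope bound makes [y] an almost minimizer of [F + K], where [K] smooths
    [(L + e / 2) |. - y|]. After a further smooth perturbation of Lipschitz constant [e / 2], a
    minimizer [z] admits no certificate inside [S], hence none in [X], and Hahn-Banach yields a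
    functional on all of [X]. *)
Lemma asplund_subgradient (X : completeNormedModType R) (A : set X) (F : X -> R)
    y (L rho : R) : asplund X -> epi_closed A F -> A y -> 0 <= L -> 0 < rho ->
  (forall x, A x -> `|x - y| <= rho -> F y - L * `|x - y| <= F x) ->
  forall e, 0 < e -> exists z (v : dual X), [/\ `|z - y| < e,
    forall h, `|v h| <= (L + e) * `|h| & frechet_subgrad A F z v].
Proof.
move=> asX FA Ay L0 rho0 Fy e e0; set c := L + e.
have e2 : 0 < e / 2 by rewrite divr_gt0.
have [S [Sy cS sepS witS]] :=
  @separable_witnesses R X _ (violation A F c) y (violation_open A F c).
pose T := submod S; pose yT : T := Submod Sy.
have [d d_dense] := separable_dense_seq (asX S sepS).
pose rho' := Order.min e rho.
have rho'0 : 0 < rho' by rewrite lt_min e0.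
have c0 : 0 < c by rewrite ltr_wpDl.
have c1 : 0 < L + e / 2 by rewrite ltr_wpDl.
(* The smoothing error [(L + e / 2) * s] is exactly the slack that the variational principle grants
   at [y]. *)
pose s := (e / 2) * rho' / 32 / (L + e / 2).
have s0 : 0 < s by rewrite !divr_gt0// mulr_gt0.
pose N t (x : T) : R := smooth_norm d t x.
have NP t : 0 < t -> [/\ smooth_convex (N t), lip 1 (N t) &
    forall x, `|x| - t <= N t x <= `|x|].
  move=> t0; split; first exact: smooth_norm_smooth.
    by move=> x x'; rewrite mul1r smooth_norm_lipschitz.
  by move=> x; rewrite le_smooth_norm//= smooth_norm_le.
have [_ scl add _] := @smooth_convex_class R T.
pose K x := (L + e / 2) * N s (x - yT).
have [scN lN bN] := NP _ s0.
have scK : smooth_convex K by apply: (scl _ _ _ scN); exact: ltW.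
have lK : lip (L + e / 2) K.
  by have := lip_scale_shift yT (ltW c1) lN; rewrite mulr1.
(* The slope bound holds on this ball; [z] will lie in its interior, so it minimizes locally over
   [A] in [S]. *)
pose A1 : set T := (@submod_val R X S) @^-1` A `&` [set x | `|x - yT| <= rho].
pose F1 (x : T) := F (submod_val x) + K x.
have FA1 : epi_closed A1 F1.
  apply: epi_closedD; first exact: lip_continuous lK.
  apply: epi_closedI; last first.
    by apply: epi_closed_comp FA; exact: submod_val_continuous.
  by apply: (@closed_comp _ _ _ [set r : R | r <= rho]) => [x _|];
    [exact: norm_continuous_sub|exact: closed_le].
have A1y : A1 yT by split=> //=; rewrite subrr normr0 ltW.
have F1lb x : A1 x -> F y - (L + e / 2) * s <= F1 x.
  move=> [Ax xy]; have := Fy _ Ax.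
  have -> : `|submod_val x - y| = `|x - yT| by rewrite submod_normE submod_valB.
  move=> /(_ xy); have /andP[+ _] := bN (x - yT).
  move=> /(ler_wpM2l (ltW c1)); rewrite /F1 /K.
  have : 0 <= e / 2 * `|x - yT| by rewrite mulr_ge0// ltW.
  move: (`|x - yT|) (N s _) (F _) (F _) (e / 2).
  by clearbody s; clear => *; lra.
have F1y : F1 yT <= F y - (L + e / 2) * s + (e / 2) * rho' / 32.
  rewrite /F1 /K subrr.
  have -> : (L + e / 2) * s = e / 2 * rho' / 32.
    by rewrite /s mulrC divfK// gt_eqF.
  rewrite subrK -[leRHS]addr0 lerD2l mulr_ge0_le0 ?(ltW c1)//.
  by have /andP[_] := bN 0; rewrite normr0.
have [z [G [[Az zrho] zy scG lG minz]]] := variational_principle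
  (submod_complete cS) (@smooth_convex_class R T) NP FA1 A1y F1lb e2 rho'0 F1y.
have zy' : `|z - yT| < rho by rewrite (lt_le_trans zy)// ge_min lexx orbT.
pose G1 x := K x + G x.
have scG1 : smooth_convex G1 by exact: add.
have lG1 : lip c G1.
  have -> : c = L + e / 2 + e / 2 by rewrite -addrA -splitr.
  exact: lip_add.
have gap0 : 0 < rho - `|z - yT| by rewrite subr_gt0.
have exk n : exists k : nat, forall h : T, `|h| < k.+1%:R^-1 ->
   `|h| < rho - `|z - yT| /\
   G1 (z + h) + G1 (z - h) - 2 * G1 z <= n.+1%:R^-1 * `|h|.
  have [|b b0 bP] := scG1.2 z n.+1%:R^-1; first by rewrite invr_gt0.
  have m0 : 0 < Order.min b (rho - `|z - yT|) by rewrite lt_min b0.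
  have [k _ /(_ k (leqnn k)) /=] := cvgr_lt _ (@cvg_harmonic R) _ m0.
  rewrite lt_min => /andP[kb kr]; exists k => h hk.
  by split; [exact: lt_trans hk kr|apply: bP; exact: lt_trans hk kb].
have [k kP] := choice exk.
exists (submod_val z).
have Sz x : submod_val (x : T) \in S by case: x.
have [|v [vc Fv]] :=
  @no_violation_subgrad R X A F c (submod_val z) k (ltW c0) Az.
(* By the choice of [S], a certificate at [z] with points in [X] can be replaced by one with points
   in [S]. *)
- move=> a ws az ak vio.
  have [ws' [lam [lam0 Aws viol]] Sws] := witS a _ (Sz z) (ex_intro _ ws vio).
  pose wT i : T := Submod (Sws i).
  have vio' : violation (@submod_val R X S @^-1` A) (F \o @submod_val R X S) c a z wT.
    exists lam; split=> //; apply: le_lt_trans viol; rewrite lerD2l.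
    rewrite ler_wpM2l ?(ltW c0)// submod_normE.
    suff -> : submod_val (\sum_(i < size a.2) lam i *: (wT i - z)) =
      \sum_(i < size a.2) lam i *: (ws' i - submod_val z) by [].
    by apply: (big_morph (@submod_val R X S)).
  apply: (smooth_min_no_violation scG1 lG1 _ kP az ak vio') => w Aw wz.
  rewrite /G1/= !addrA; apply: minz; split=> //=.
  rewrite -(subrKA z) (le_trans (ler_normD _ _))//.
  by move: wz; move: (`|_|) (`|_|); clear => *; lra.
- exists v; split=> //; have := zy; rewrite submod_normE submod_valB => zy1.
  by rewrite (lt_le_trans zy1)// ge_min lexx.
Qed.

End AsplundSubgradient.

(** * Ekeland's principle *)

Section Ekeland.
Context {R : realType} {X : completeNormedModType R}.

(** The variational principle with the exact norm, on the set [A'] that encodes the first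
    inequality. Points of [A] outside [A'] satisfy the second one by the triangle inequality. *)
Lemma ekeland (A : set X) (F : X -> R) y (M eps : R) :
  epi_closed A F -> A y -> (forall x, A x -> M <= F x) -> 0 < eps ->
  exists z, [/\ A z, F z + eps * `|z - y| <= F y &
    forall x, A x -> F z - eps * `|x - z| <= F x].
Proof.
move=> FA Ay FM e0.
pose D x := eps * `|x - y|.
have cD : continuous D.
  by move=> x; apply: cvgM; [exact: cvg_cst|exact: norm_continuous_sub].
pose A' := A `&` [set x | F x + D x <= F y].
have FA' : epi_closed A' F.
  move=> u z l Au uz Fu; have [i|Az Fz] := FA u z l _ uz Fu.
    exact: (Au i).1.
  split=> //; split=> //; have [i||e e'0|] := @epi_closedD R X A F D cD FA u z (F y).
  - exact: (Au i).1.
  - exact: uz.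
  - by apply: nearW => i; rewrite (le_trans (Au i).2)// lerDl ltW.
  - by [].
have A'y : A' y by split; rewrite //= /D subrr normr0 mulr0 addr0.
(* Large enough for [F y <= M + eps * rho / 32], whatever the value at [y]. *)
pose rho := 32 * (F y - M + 1) / eps.
have g0 : 0 < F y - M + 1 by rewrite ltr_wpDl// subr_ge0 FM.
have rho0 : 0 < rho by rewrite divr_gt0// mulr_gt0.
have [||z [G [[Az Dz] _ _ lG minz]]] := variational_principle (N := fun _ x => `|x|)
   (@complete_geometrically R X) (@perturbation_classT R X) _ FA' A'y
   (fun x A'x => FM x A'x.1) e0 rho0 _.
- move=> s s0; split=> // [x x'|x]; first by rewrite mul1r ler_dist_dist.
  by rewrite lexx andbT gerBl ltW.
- have -> : eps * rho / 32 = F y - M + 1 by rewrite /rho; field; rewrite gt_eqF.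
  by move: (F y); clear => *; lra.
exists z; split=> // x Ax.
have [Dx|Dx] := leP (F x + D x) (F y).
  have := minz x (conj Ax Dx); have := lG x z; rewrite ler_norml => /andP[_].
  by move: (eps * _) (G x) (G z) (F x) (F z); clear => *; lra.
have : D x <= eps * `|x - z| + D z.
  by rewrite -mulrDr ler_wpM2l ?(ltW e0)// -{1}(subrKA z) ler_normD.
by move: Dz Dx => /=; move: (D x) (D z) (eps * _) (F x) (F y) (F z); clear => *; lra.
Qed.

End Ekeland.

(** * The growth function, and growth from slope bounds *)

Section Growth.
Context {R : realType}.
Variables (q : R) (q0 : 0 < q).

(** For [t >= 0], the primitive of [t^(1/q)] that vanishes at 0. *)
Definition theta (t : R) : R := q / (1 + q) * t `^ ((1 + q) / q).

Let q1 : 0 < 1 + q. Proof. by rewrite addr_gt0. Qed.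
Let p0 : 0 < (1 + q) / q. Proof. by rewrite divr_gt0. Qed.

Lemma theta0 : theta 0 = 0.
Proof. by rewrite /theta powR0 ?mulr0// gt_eqF. Qed.

Lemma theta_ge0 t : 0 <= theta t.
Proof. by rewrite mulr_ge0 ?powR_ge0// divr_ge0// ltW. Qed.

Lemma powR_exponentE t : 0 <= t -> t `^ ((1 + q) / q) = t * t `^ q^-1.
Proof.
move=> t0; rewrite -{2}(powRr1 t0) -powRD; last first.
  by rewrite gt_eqF// addr_gt0// invr_gt0.
by congr (_ `^ _); rewrite mulrDl mul1r divff ?gt_eqF// addrC.
Qed.

Lemma thetaE t : 0 <= t -> theta t = q / (1 + q) * (t * t `^ q^-1).
Proof. by move=> t0; rewrite /theta powR_exponentE. Qed.

(** The tangent inequality at [t] for a convex function of slope [t^(1/q)]; it is Young's inequality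
    for [s] and [t^(1/q)] with exponents [(1 + q) / q] and [1 + q]. *)
Lemma theta_tangent s t : 0 <= s -> 0 <= t ->
  theta t - theta s <= t `^ q^-1 * (t - s).
Proof.
move=> s0 t0.
have h : ((1 + q) / q)^-1 + (1 + q)^-1 = 1.
  by rewrite invf_div -[X in _ + X]mul1r -mulrDl addrC divff// gt_eqF.
have := conjugate_powR s0 (powR_ge0 t q^-1) p0 q1 h.
rewrite -(powRrM t) (_ : q^-1 * (1 + q) = (1 + q) / q); last by rewrite mulrC.
rewrite /theta (powR_exponentE t0) invf_div; set a := t `^ q^-1.
set b := s `^ _ => yo.
have : q / (1 + q) * (t * a) + t * a / (1 + q) = t * a.
  by field; rewrite gt_eqF.
by move: yo; move: (q / (1 + q)) => u; clear; move: (_ / _) => *; lra.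
Qed.

Lemma theta_lip s t : 0 <= s -> 0 <= t ->
  `|theta t - theta s| <= (Order.max s t) `^ q^-1 * `|t - s|.
Proof.
move=> s0 t0; wlog st : s t s0 t0 / s <= t.
  move=> H; have [st|/ltW ts] := leP s t; first by have := H s t s0 t0 st; rewrite max_r.
  by have := H t s t0 s0 ts; rewrite max_r// distrC (distrC t).
rewrite max_r// [X in _ <= _ * X]ger0_norm ?subr_ge0//.
rewrite ger0_norm ?theta_tangent// subr_ge0 /theta ler_wpM2l ?divr_ge0 ?(ltW q0) ?(ltW q1)//.
by apply: ge0_ler_powR; rewrite ?nnegrE ?(ltW p0).
Qed.

Lemma theta_comp_continuous (X : normedModType R) (m : X -> R) :
  (forall x, 0 <= m x) -> lip 1 m -> continuous (theta \o m).
Proof.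
move=> m0 lm x; apply/cvgrPdist_le => e e0.
set K := (m x + 1) `^ q^-1.
have K0 : 0 < K by rewrite powR_gt0// ltr_wpDl.
have d0 : 0 < Order.min 1 (e / K) by rewrite lt_min ltr01 divr_gt0.
have idx : id y @[y --> x] --> x by exact: cvg_id.
have /cvgrPdist_le/(_ _ d0) := idx; apply: filterS => y /=.
rewrite le_min => /andP[xy1 xye].
have lxy := lm x y; rewrite mul1r in lxy.
apply: (le_trans (theta_lip (m0 y) (m0 x))); rewrite mulrC.
apply: (@le_trans _ _ (e / K * K)); last by rewrite divfK// gt_eqF.
apply: ler_pM; rewrite ?powR_ge0 ?(le_trans lxy)//.
apply: ge0_ler_powR; rewrite ?nnegrE ?invr_ge0 ?(ltW q0) ?le_max ?m0 ?addr_ge0//.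
rewrite ge_max lerDl ler01 andbT.
have := lm y x; rewrite mul1r distrC (distrC y) ler_norml => /andP[h _].
by move: h xy1; move: (`|_|); clear => *; lra.
Qed.

Lemma powRVK (a : R) : 0 <= a -> (a `^ q^-1) `^ q = a.
Proof. by move=> a0; rewrite -powRrM mulVf ?powRr1// gt_eqF. Qed.

Lemma powRKV (a : R) : 0 <= a -> (a `^ q) `^ q^-1 = a.
Proof. by move=> a0; rewrite -powRrM mulfV ?powRr1// gt_eqF. Qed.

(* Apply Ekeland's principle to [g + b |theta m - theta (m x0)|], where [b]
   lies strictly between [max al r] and [c]: the second term is Lipschitz near
   [z] with constant close to [b m(z)^(1/q)], so the descent rate of [g] at the
   almost minimizer [z] is less than the rate [c m(z)^(1/q)] which [slope]
   guarantees. *)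
Lemma growth_of_slope (X : completeNormedModType R) (A : set X) (g m : X -> R)
    xbar (rho r kt c al : R) :
  epi_closed A g -> 0 < rho -> (forall x, 0 <= m x) -> lip 1 m ->
  (forall x, m x <= `|x - xbar|) ->
  (forall x, A x -> - (r * theta (m x)) <= g x) ->
  (forall y L L', A y -> `|y - xbar| < rho -> 0 < L -> L < L' ->
     (exists2 tau, 0 < tau &
       forall x, A x -> `|x - y| <= tau -> g y - L * `|x - y| <= g x) ->
     m y <= kt * L' `^ q) ->
  0 < kt -> 0 < c -> kt * c `^ q = 1 -> 0 < r < c -> 0 < al < c ->
  exists2 eta, 0 < eta &
    forall x, A x -> `|x - xbar| <= eta -> al * theta (m x) <= g x.
Proof.
move=> gA rho0 m0 lm mx glb slope kt0 c0 ktc /andP[r0 rc] /andP[al0 alc].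
pose a := Order.max al r.
have ac : a < c by rewrite gt_max alc.
have [aal ar] : al <= a /\ r <= a by rewrite !le_max !lexx orbT.
(* [b1] weights the penalty, [b2 - b1] leaves room for Ekeland's error, [b3 - b2] for the variation
   of [m] near [z], and [b3 < c] gives the contradiction. *)
pose b1 := a + (c - a) / 4; pose b2 := a + (c - a) / 2; pose b3 := a + 3 * (c - a) / 4.
have ca : 0 < c - a by rewrite subr_gt0.
have ab1 : a < b1 by rewrite /b1; lra.
have b12 : b1 < b2 by rewrite /b1 /b2; lra.
have b23 : b2 < b3 by rewrite /b2 /b3; lra.
have b3c : b3 < c by rewrite /b3; lra.
have a0 : 0 < a by rewrite (lt_le_trans al0).
have b10 := lt_trans a0 ab1; have b20 := lt_trans b10 b12.
have b30 := lt_trans b20 b23.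
clearbody a b1 b2 b3.
(* [kap] will bound [theta (m z) / theta (m x0)] from below at the almost minimizer [z]; [k1] is the
   resulting factor for [m^(1/q)]. *)
pose kap := (b1 - al) / (r + b1).
have rb : 0 < r + b1 by rewrite addr_gt0.
have kap0 : 0 < kap by rewrite divr_gt0// subr_gt0 (le_lt_trans aal).
pose k1 := (kap `^ ((1 + q) / q)^-1) `^ q^-1.
have k10 : 0 < k1 by rewrite !powR_gt0.
have b21 : 0 < b2 - b1 by rewrite subr_gt0.
(* [C * m x0] will bound [|z - x0|], so that [x0] close to [xbar] keeps [z] within [rho] of
   [xbar]. *)
pose C := (al + r) * (q / (1 + q)) / ((b2 - b1) * k1).
have C0 : 0 < C.
  apply: divr_gt0; last exact: mulr_gt0.
  by apply: mulr_gt0; [exact: addr_gt0|exact: divr_gt0].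
have C1 : 0 < 1 + C by rewrite addr_gt0.
exists (rho / 2 / (1 + C)); first by rewrite !divr_gt0.
move=> x0 Ax0 x0eta; rewrite leNgt; apply/negP => gx0.
set m0' := m x0 in gx0.
have m0gt : 0 < m0'.
  rewrite lt_neqAle m0 andbT eq_sym; apply/eqP => mx00.
  by have := glb _ Ax0; rewrite -/m0' mx00 theta0 mulr0 oppr0 leNgt;
    move: gx0; rewrite mx00 theta0 mulr0 => ->.
pose mr := m0' `^ q^-1.
have mr0 : 0 < mr by rewrite powR_gt0.
pose eps := (b2 - b1) * (k1 * mr).
have eps0 : 0 < eps by rewrite !mulr_gt0.
have th0 : theta m0' = q / (1 + q) * (m0' * mr) by rewrite thetaE// ltW.
pose pen x := b1 * `|theta (m x) - theta m0'|.
have cm := lip_continuous lm.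
have cpen : continuous pen.
  move=> x; apply: cvgM; first exact: cvg_cst.
  apply: cvg_norm; apply: cvgB; last exact: cvg_cst.
  exact: theta_comp_continuous.
have Hlb x : A x -> - (r * theta m0') <= g x + pen x.
  move=> Ax; have := glb _ Ax; rewrite /pen => gx.
  have := theta_ge0 (m x); have := theta_ge0 m0'.
  move: gx; set u := theta (m x); set v := theta m0' => gx v0 u0.
  have : r * `|u - v| <= b1 * `|u - v| by rewrite ler_wpM2r// ltW// (le_lt_trans ar).
  have : r * (u - v) <= r * `|u - v| by rewrite ler_wpM2l ?(ltW r0)// ler_norm.
  by move: gx; move: (_ * `|_|) (_ * `|_|); clear => *; lra.
have [z [Az Hz minz]] := ekeland (epi_closedD cpen gA) Ax0 Hlb eps0.
have pen0 : pen x0 = 0 by rewrite /pen subrr normr0 mulr0.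
rewrite pen0 addr0 in Hz.
have zx0 : `|z - x0| <= C * m0'.
  have : eps * `|z - x0| <= (al + r) * theta m0'.
    by move: (Hlb _ Az) Hz gx0; move: (_ * `|_|) (pen z) (theta _); clear => *; lra.
  rewrite -ler_pdivlMl// => /le_trans; apply.
  rewrite th0 /C /eps le_eqVlt; apply/orP; left; apply/eqP; field.
  by rewrite !gt_eqF// ?subr_gt0.
have zbar : `|z - xbar| < rho.
  have : (1 + C) * `|x0 - xbar| <= rho / 2 by rewrite mulrC -ler_pdivlMr.
  have : C * m0' <= C * `|x0 - xbar| 
    by apply: ler_wpM2l; [exact: ltW|exact: mx].
  have := ler_normD (z - x0) (x0 - xbar); rewrite subrKA.
  move: zx0 rho0; move: (`|_|) (`|_|) (`|_|) (C * m0') => ? ? ? ?; clear.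
  by move=> *; lra.
have thz : kap * theta m0' <= theta (m z).
  rewrite /kap mulrAC ler_pdivrMr//.
  have : b1 * (theta m0' - theta (m z)) <= pen z.
    by rewrite /pen ler_wpM2l ?(ltW b10)// distrC ler_norm.
  have : 0 <= eps * `|z - x0| by rewrite mulr_ge0// ltW.
  move: (glb _ Az) Hz gx0; move: (eps * _) (pen z) (theta _) (theta _).
  by clear => *; lra.
have mzpos : 0 < m z.
  rewrite lt_neqAle m0 andbT eq_sym; apply/eqP => mz0.
  move: thz; rewrite mz0 theta0 leNgt mulr_gt0// th0 mulr_gt0 ?divr_gt0//.
  by rewrite mulr_gt0.
pose zr := (m z) `^ q^-1.
have zr0 : 0 < zr by rewrite powR_gt0.
have epsz : eps <= (b2 - b1) * zr.
  rewrite ler_wpM2l ?(ltW b21)//.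
  move: thz; rewrite /theta mulrCA ler_pM2l ?divr_gt0// => h.
  have : (kap * m0' `^ ((1 + q) / q)) `^ ((1 + q) / q)^-1 <= m z.
    have -> : m z = (m z `^ ((1 + q) / q)) `^ ((1 + q) / q)^-1.
      by rewrite -powRrM mulfV ?powRr1// gt_eqF.
    apply: ge0_ler_powR => //; rewrite ?nnegrE ?invr_ge0 ?(ltW p0) ?powR_ge0//.
    by rewrite mulr_ge0 ?powR_ge0// ltW.
  rewrite powRM ?powR_ge0 ?(ltW kap0)// -(powRrM m0') mulfV ?gt_eqF//.
  rewrite powRr1 ?(ltW m0gt)// => h'.
  have : (kap `^ ((1 + q) / q)^-1 * m0') `^ q^-1 <= zr.
    apply: ge0_ler_powR => //; rewrite ?nnegrE ?invr_ge0 ?(ltW q0)//.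
    by rewrite mulr_ge0 ?powR_ge0// ltW.
  by rewrite powRM ?powR_ge0 ?(ltW m0gt).
(* [tau] is a radius about [z] on which [|theta (m x) - theta (m z)|], times [b1], is at most
   [b1' * zr * |x - z|]. *)
pose b1' := b1 + (b3 - b2) / 2.
have b11 : b1 < b1' by rewrite ltrDl divr_gt0// subr_gt0.
have b1'0 : 0 < b1' / b1 by rewrite divr_gt0// (lt_trans b10).
have bq1 : 1 < (b1' / b1) `^ q.
  have := @gt0_ltr_powR R q q0 1 (b1' / b1).
  by rewrite powR1 !nnegrE ler01 (ltW b1'0) ltr_pdivlMr// mul1r; apply.
pose tau := ((b1' / b1) `^ q - 1) * m z.
have tau0 : 0 < tau by rewrite mulr_gt0// subr_gt0.
have tauE : b1 * (m z + tau) `^ q^-1 = b1' * zr.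
  rewrite /tau mulrBl mul1r addrC subrK (powRM _ (powR_ge0 _ _) (m0 z)).
  by rewrite powRKV ?(ltW b1'0)// mulrA (mulrC b1) divfK// gt_eqF.
have L0 : 0 < eps + b1' * zr by rewrite addr_gt0// mulr_gt0// (lt_trans b10).
have LL' : eps + b1' * zr < b3 * zr.
  apply: (@le_lt_trans _ _ ((b2 - b1 + b1') * zr)).
    by rewrite [leRHS]mulrDl lerD2r.
  by rewrite ltr_pM2r// /b1'; move: b23; clear; lra.
have : m z <= kt * (b3 * zr) `^ q.
  apply: (slope z _ _ Az zbar L0 LL'); exists tau => // x Ax xz.
  have := minz x Ax.
  have mxz : m x <= m z + tau.
    have := lm x z; rewrite mul1r ler_norml => /andP[_].
    by move: xz; move: (`|_|); clear => *; lra.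
  have thl : b1 * `|theta (m x) - theta (m z)| <= b1' * zr * `|x - z|.
    rewrite -tauE -mulrA ler_wpM2l ?(ltW b10)//.
    apply: (le_trans (theta_lip (m0 z) (m0 x))).
    apply: ler_pM => //; first exact: powR_ge0; last first.
      by have := lm x z; rewrite mul1r.
    apply: ge0_ler_powR; rewrite ?nnegrE ?invr_ge0 ?(ltW q0) ?le_max ?m0//.
      by rewrite addr_ge0 ?m0// ltW.
    by rewrite ge_max mxz lerDl ltW.
  have : pen x <= pen z + b1 * `|theta (m x) - theta (m z)|.
    rewrite /pen -mulrDr ler_wpM2l ?(ltW b10)// [leRHS]addrC.
    by rewrite -[X in `|X| <= _](subrKA (theta (m z))) ler_normD.
  move: thl; rewrite [X in g z - X]mulrDl.
  move: (eps * _) (b1' * _ * _) (b1 * _) (pen x) (pen z) (g x) (g z).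
  by clear => *; lra.
(* The slope bound becomes [m z <= kt * b3^q * m z], impossible since [kt * b3^q < kt * c^q = 1]. *)
rewrite powRM ?(ltW b30) ?(ltW zr0)// powRVK// mulrA.
rewrite -[X in X <= _]mul1r ler_pM2r// leNgt -ktc ltr_pM2l//.
by rewrite gt0_ltr_powR// nnegrE ltW.
Qed.

End Growth.

(** * Real-valued distance to a nonempty set *)

Section Distance.
Context {R : realType} {X : normedModType R}.
Implicit Types (x w : X) (S : set X).

Definition rdist x S : R := inf [set `|x - w| | w in S].

Lemma dist_set_real x S : S !=set0 -> dist_set x S = (rdist x S)%:E.
Proof.
move=> [w Sw]; rewrite /dist_set /rdist -ereal_inf_EFin.
- by rewrite image_comp.
- by exists 0 => _ [w' _ <-].
- by exists `|x - w|, w.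
Qed.

Lemma rdist_le x w S : S w -> rdist x S <= `|x - w|.
Proof. by move=> Sw; apply: ge_inf; [exists 0 => _ [w' _ <-]|exists w]. Qed.

Lemma rdist_ge0 x S : S !=set0 -> 0 <= rdist x S.
Proof.
by move=> [w Sw]; apply: lb_le_inf => [|_ [w' _ <-]//]; exists `|x - w|, w.
Qed.

Lemma rdist_adherent x S (e : R) : S !=set0 -> 0 < e ->
  exists2 w, S w & `|x - w| < rdist x S + e.
Proof.
move=> [w Sw] e0.
have [|_ [w' Sw' <-] h] := @inf_adherent R [set `|x - w| | w in S] e e0.
  by split; [exists `|x - w|, w|exists 0 => _ [w' _ <-]].
by exists w'.
Qed.

Lemma rdist_lip S : S !=set0 -> lip 1 (rdist^~ S).
Proof.
move=> S0 x y; have h a b : rdist a S - rdist b S <= `|a - b|.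
  apply/ler_addgt0Pr => e e0; have [w Sw bw] := rdist_adherent b S0 e0.
  have := rdist_le a Sw; have := ler_normD (a - b) (b - w); rewrite subrKA.
  move: bw; move: (`|a - w|) (`|b - w|) (`|a - b|) (rdist _ _) (rdist _ _).
  by clear => *; lra.
by rewrite mul1r ler_norml h andbT lerNl opprB -normrN opprB h.
Qed.

(* The right-hand side is [+oo] when [D] is empty. *)
Lemma le_poweR_dist (a q : R) (D : set X) x : 0 < q -> 0 <= a ->
  (forall w, D w -> a <= `|x - w|) -> ((a `^ q)%:E <= dist_set x D `^ q)%E.
Proof.
move=> q0 a0 aD.
have : (a%:E <= dist_set x D)%E.
  by apply: le_ereal_inf_tmp => _ [w Dw <-]; rewrite lee_fin aD.
case: (dist_set x D) => [d||]//=.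
  rewrite !lee_fin => ad; apply: ge0_ler_powR; rewrite ?nnegrE ?(ltW q0)//.
  exact: le_trans ad.
by move=> _; rewrite (gt_eqF q0) leey.
Qed.

Lemma poweR_dist_le (q : R) (D : set X) x w : 0 < q -> D w ->
  (dist_set x D `^ q <= (`|x - w| `^ q)%:E)%E.
Proof.
move=> q0 Dw; have D0 : D !=set0 by exists w.
rewrite dist_set_real//= lee_fin; apply: ge0_ler_powR; rewrite ?nnegrE ?(ltW q0)//.
  exact: rdist_ge0.
exact: rdist_le.
Qed.

End Distance.

(** * Regular subgradients and lower semicontinuity *)

Section SubdifferentialFacts.
Context {R : realType} {X : normedModType R}.
Variables (f : X -> \bar R) (f_proper : forall x, f x != -oo%E).

Lemma fineE x : dom f x -> f x = (fine (f x))%:E.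
Proof.
by move=> fx; rewrite fineK// fin_numE f_proper/= lt_eqF.
Qed.

Lemma regular_subdiff_subdiff x : regular_subdiff f x `<=` subdiff f x.
Proof.
move=> v fv; split; first exact: fv.1.
exists (fun=> x), (fun=> v); split=> //.
- exact: cvg_cst.
- exact: cvg_cst.
- exact: cvg_cst.
Qed.

Lemma regular_subdiff_intro x (v : dual X) : dom f x ->
  (forall e, 0 < e -> exists2 d, 0 < d & forall w, `|w - x| < d ->
     ((fine (f x) + (v (w - x) : R) - e * `|w - x|)%:E <= f w)%E) ->
  regular_subdiff f x v.
Proof.
move=> fx fv; split=> //; rewrite limf_einfE; apply/lee_subgt0Pr => e e0.
have [d d0 dP] := fv e e0; apply: le_ereal_sup_tmp.
pose Q w := ((f w - f x - (v (w - x))%:E) * (`|w - x|^-1)%:E)%E.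
exists (ereal_inf (Q @` [set w | `|w - x| < d /\ w != x])).
  exists [set w | `|w - x| < d /\ w != x] => //.
  apply/nbhs_ballP; exists d => //= w xw wx; split=> //.
  by move: xw; rewrite -ball_normE/= distrC.
apply: le_ereal_inf_tmp => _ [w [wd wx] <-]; rewrite /Q sub0e.
have nw : 0 < `|w - x| by rewrite normr_gt0 subr_eq0.
have := dP w wd; rewrite {2}(fineE fx).
case: (f w) => [s||]//=; last first.
  move=> _; rewrite [X in (_ <= X * _)%E](_ : _ = +oo%E :> \bar R)//.
  by rewrite gt0_mulye ?leey// lte_fin invr_gt0.
rewrite lee_fin => h; rewrite -!EFinD -EFinM lee_fin.
rewrite [leRHS](_ : _ = (s - fine (f x) - (v (w - x) : R)) / `|w - x|)//.
rewrite ler_pdivlMr//; move: h; move: (`|w - x|) (v (w - x) : R) (fine _).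
by clear => *; lra.
Qed.

(** The limit [z] stays in the smaller closed ball, where [f] is lower semicontinuous; this gives
    [f z <= l], which also puts [z] in the domain. *)
Lemma lsc_epi_closed xbar (rho rho0 : R) : rho < rho0 ->
  (forall x, `|x - xbar| < rho0 -> lsc_at f x) ->
  epi_closed [set x | dom f x /\ `|x - xbar| <= rho] (fine \o f).
Proof.
move=> rr lf u z l Au uz Fu.
have zx : `|z - xbar| <= rho.
  have c : `|u i - xbar| @[i --> \oo] --> `|z - xbar|.
    by apply: cvg_norm; apply: cvgB; [exact: uz|exact: cvg_cst].
  by apply: (cvgr_to_le c); apply: nearW => i; exact: (Au i).2.
have lz := lf z (le_lt_trans zx rr).
have fl : (f z <= l%:E)%E.
  rewrite leNgt; apply/negP => lfz.
  have [a la afz] : exists2 a : R, l < a & (a%:E < f z)%E.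
    move: lfz; case: (f z) => [s| |]//=.
      by rewrite lte_fin => ls; exists ((l + s) / 2); rewrite ?lte_fin; lra.
    by exists (l + 1); rewrite ?ltry// ltrDl.
  have e0 : 0 < (a - l) / 2 by rewrite divr_gt0// subr_gt0.
  have h1 : \forall i \near \oo, (a%:E < f (u i))%E by exact: uz (lz a afz).
  have [i [/= h2 h3]] := filter_ex (filterI h1 (Fu _ e0)).
  by move: h2; rewrite (fineE (Au i).1) lte_fin; move: h3 => /=; lra.
have fz : dom f z by rewrite /dom/= (le_lt_trans fl)// ltry.
by split=> //=; rewrite -lee_fin -fineE.
Qed.

End SubdifferentialFacts.

Lemma closed_ball_le (R : realType) (X : normedModType R) (x y : X) (r : R) :
  0 < r -> closed_ball x r y <-> `|y - x| <= r.
Proof. by move=> r0; rewrite closed_ballE// /closed_ball_/= distrC. Qed.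

(** * The two implications between subregularity and growth *)

Section SubregularityGrowth.
Context {R : realType} {X : completeNormedModType R}.
Variables (f : X -> \bar R) (xbar : X) (xsbar : dual X) (q : R).
Hypotheses (f_proper : forall x, f x != -oo%E) (fxbar : dom f xbar)
  (subxbar : subdiff f xbar xsbar) (q0 : 0 < q).

Let S := svinv (subdiff f) xsbar.
Let m x := rdist x S.
Let S0 : S !=set0. Proof. by exists xbar. Qed.
Let affine x : R := fine (f xbar) + (xsbar (x - xbar) : R).

Let mx x : m x <= `|x - xbar|. Proof. exact: rdist_le. Qed.
Let m0 x : 0 <= m x. Proof. exact: rdist_ge0. Qed.

Lemma growth_boundE s x :
  (f xbar + (xsbar (x - xbar))%:E + (q * s / (1 + q))%:E *
     dist_set x S `^ ((1 + q) / q))%E = (affine x + s * theta q (m x))%:E.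
Proof.
rewrite dist_set_real// (fineE f_proper fxbar) poweR_EFin -EFinM -!EFinD.
by congr (_ + _)%:E; rewrite /theta mulrA; congr (_ * _); rewrite mulrAC mulrC.
Qed.

Lemma minorant_boundE s x :
  (f xbar + (xsbar (x - xbar))%:E - (q * s / (1 + q))%:E *
     dist_set x S `^ ((1 + q) / q))%E = (affine x - s * theta q (m x))%:E.
Proof.
rewrite dist_set_real// (fineE f_proper fxbar) poweR_EFin -EFinM -EFinN -!EFinD.
by congr (_ - _)%:E; rewrite /theta mulrA; congr (_ * _); rewrite mulrAC mulrC.
Qed.

Lemma dualB_le (v w : dual X) x : (v x : R) - w x <= `|v - w| * `|x|.
Proof. exact: le_trans (ler_norm _) (dual_norm_ub (v - w) x). Qed.

Lemma dual_sub (v : dual X) x y : v (x - y) = (v x : R) - v y :> R.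
Proof. exact: (linearB v). Qed.

Lemma growth_subregular (al eta be : R) : 0 < eta -> 0 < be < al ->
  growth f xbar xsbar q al eta ->
  local_subgradient_estimate f xbar xsbar q eta be ->
  exists2 kt : R, 0 < kt & subregular_with_minorant f xbar xsbar q kt.
Proof.
move=> eta0 /andP[be0 beal] gr est.
pose W := eta + (q * eta / (1 + q)) `^ q^-1.
have W0 : 0 < W by rewrite ltr_wpDr ?powR_ge0.
have q1 : 0 < 1 + q by rewrite addr_gt0.
pose c0 := (al - be) * (q / (1 + q)).
have c00 : 0 < c0 by rewrite mulr_gt0 ?subr_gt0// divr_gt0.
pose ga := Order.min eta (W / 4).
have W4 : 0 < W / 4 by rewrite divr_gt0.
have ga0 : 0 < ga by rewrite lt_min eta0.
have [gae gaW] : ga <= eta /\ ga <= W / 4 by rewrite !ge_min !lexx orbT.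
(* The first summand serves [v] with [|xsbar - v| < ga]; the second serves the others, for which
   [m x <= ga] suffices. *)
pose kt := c0^-1 `^ q + ga / ga `^ q.
have kt0 : 0 < kt by rewrite addr_gt0 ?divr_gt0 ?powR_gt0 ?invr_gt0.
exists kt => //; split; last first.
  (* Growth implies the minorant inequality for any positive [r]; half the threshold is taken. *)
  pose c := q / (q * kt `^ q^-1).
  have c_gt0 : 0 < c by rewrite divr_gt0// mulr_gt0// powR_gt0.
  exists eta, (c / 2); split=> //.
    by rewrite -/c divr_gt0//= ltr_pdivrMr// ltr_pMr// ltr1n.
  move=> x /gr; apply: le_trans; rewrite growth_boundE minorant_boundE lee_fin.
  have := theta_ge0 q0 (m x) => t0.
  have : 0 <= al * theta q (m x) by rewrite mulr_ge0// ltW// (lt_trans be0).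
  have : 0 <= c / 2 * theta q (m x) by rewrite mulr_ge0// ltW// divr_gt0.
  by move: (_ * _) (_ * _) (affine x)=> *; lra.
exists ga => // x /closed_ball_le-/(_ ga0) xga.
suff key v : subdiff f x v -> m x <= kt * `|xsbar - v| `^ q.
  rewrite dist_set_real// -/S -/(m x).
  have kt1 : 0 <= m x / kt by rewrite divr_ge0// ltW.
  apply: (@le_trans _ _ (kt%:E * (((m x / kt) `^ q^-1) `^ q)%:E)%E).
    by rewrite powRVK// -EFinM lee_fin mulrC divfK// gt_eqF.
  rewrite lee_wpmul2l ?lee_fin ?(ltW kt0)//.
  apply: le_poweR_dist => //; first exact: powR_ge0.
  move=> v /key; rewrite mulrC -ler_pdivrMr// => h.
  rewrite -[leRHS](powRKV q0)//.
  by apply: ge0_ler_powR; rewrite ?nnegrE ?invr_ge0 ?(ltW q0) ?powR_ge0.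
move=> fv; have fx : dom f x := fv.1.
have [far|near] := leP ga `|xsbar - v|.
  apply: (le_trans (mx x)); apply: (le_trans xga).
  apply: (@le_trans _ _ (kt * ga `^ q)).
    rewrite /kt mulrDl divfK ?gt_eqF ?powR_gt0// lerDr.
    by rewrite mulr_ge0 ?powR_ge0.
  rewrite ler_wpM2l ?(ltW kt0)//.
  by apply: ge0_ler_powR; rewrite ?nnegrE ?(ltW q0) ?(ltW ga0).
have grx : affine x + al * theta q (m x) <= fine (f x).
  rewrite -lee_fin -growth_boundE -(fineE f_proper fx); apply: gr.
  by apply/closed_ball_le => //; exact: le_trans gae.
(* The estimates at [(u, x)] and at [(xbar, u)], the latter with [d (u; S) = 0], are combined with
   growth at [x]. *)
have step u : S u -> `|u - xbar| <= W ->
    (al - be) * theta q (m x) <= `|xsbar - v| * `|x - u|.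
  move=> Su uW.
  have fu : dom f u := Su.1.
  have h1 : fine (f x) + (v (u - x) : R) - be * theta q (m x) <= fine (f u).
    rewrite -lee_fin -(fineE f_proper fu).
    have gu : (gph (subdiff f) `&` sum_ball xbar xsbar W) (u, xsbar).
      by split=> //; rewrite /sum_ball/= subrr normr0 addr0.
    have gx : (gph (subdiff f) `&` sum_ball xbar xsbar W) (x, v).
      split=> //; rewrite /sum_ball/= (distrC v); move: xga near gaW W0.
      by move: (`|x - xbar|) (`|xsbar - v|) => *; lra.
    apply: le_trans (est u x v gu gx); rewrite -/S.
    rewrite dist_set_real// poweR_EFin (fineE f_proper fx) -EFinM -EFinN -!EFinD.
    rewrite lee_fin lerD2l lerN2 /theta mulrA.
    by rewrite le_eqVlt; apply/orP; left; apply/eqP; congr (_ * _); rewrite mulrAC mulrC.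
  have h2 : fine (f u) + (xsbar (xbar - u) : R) <= fine (f xbar).
    rewrite -lee_fin -(fineE f_proper fxbar).
    have gb : (gph (subdiff f) `&` sum_ball xbar xsbar W) (xbar, xsbar).
      by split=> //; rewrite /sum_ball/= !subrr !normr0 addr0 ltW.
    have gu : (gph (subdiff f) `&` sum_ball xbar xsbar W) (u, xsbar).
      by split=> //; rewrite /sum_ball/= subrr normr0 addr0.
    apply: le_trans (est xbar u xsbar gb gu); rewrite -/S.
    have mu0 : rdist u S = 0.
      apply/eqP; rewrite eq_le m0 andbT -(normr0 X) -(subrr u).
      exact: rdist_le.
    rewrite dist_set_real// mu0 poweR_EFin powR0 ?gt_eqF ?divr_gt0// mule0 sube0.
    by rewrite (fineE f_proper fu) -EFinD.
  have := dualB_le xsbar v (u - x); rewrite (distrC u).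
  move: h1 h2 grx; rewrite /affine !dual_sub mulrBl.
  move: (_ * `|x - u|) (al * _) (be * _) (xsbar x : R) (xsbar u : R).
  move: (xsbar xbar : R) (v x : R) (v u : R) (fine _) (fine _) (fine _) => *.
  lra.
set N := `|xsbar - v| in near step *.
have N0 : 0 <= N by exact: normr_ge0.
(* Take [u] in [S] within [m x + e'] of [x]: [e' <= W / 4] keeps [u] in the ball of radius [W], and
   [e' <= e / (N + 1)] makes [N * e' <= e]. *)
have mW : (al - be) * theta q (m x) <= N * m x.
  apply/ler_addgt0Pr => e e0.
  have N1 : 0 < N + 1 by rewrite ltr_wpDl.
  have e'0 : 0 < Order.min (W / 4) (e / (N + 1)) by rewrite lt_min W4 divr_gt0.
  have [u Su xu] := rdist_adherent x S0 e'0.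
  have [e'W e'e] : Order.min (W / 4) (e / (N + 1)) <= W / 4 /\
      Order.min (W / 4) (e / (N + 1)) <= e / (N + 1).
    by rewrite !ge_min !lexx !orbT.
  move: xu e'W e'e e'0; move: (Order.min _ _) => e' xu e'W e'e e'0.
  have uW : `|u - xbar| <= W.
    have := ler_normD (u - x) (x - xbar); rewrite subrKA (distrC u x).
    move: xu e'W xga gaW (mx x) W0; rewrite -/(m x).
    by move: (`|x - u|) (`|x - xbar|) (`|u - xbar|) (m x) => *; lra.
  apply: (le_trans (step u Su uW)).
  apply: (@le_trans _ _ (N * (m x + e'))); first by rewrite ler_wpM2l// ltW.
  rewrite mulrDr lerD2l; move: e'e; rewrite ler_pdivlMr// mulrDr mulr1 mulrC.
  by apply: le_trans; rewrite lerDl ltW.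
have [mx0|mx_neq0] := eqVneq (m x) 0.
  by rewrite mx0 mulr_ge0 ?powR_ge0// ltW.
have mxp : 0 < m x by rewrite lt0r mx_neq0 m0.
move: mW; rewrite thetaE// mulrA -/c0 [leLHS]mulrCA mulrC ler_pM2r// => mW.
have {}mW : m x `^ q^-1 <= c0^-1 * N by rewrite ler_pdivlMl.
rewrite -{1}(powRVK q0 (m0 x)).
have c0N : 0 <= c0^-1 * N by rewrite mulr_ge0// invr_ge0 ltW.
apply: (@le_trans _ _ ((c0^-1 * N) `^ q)).
  by apply: ge0_ler_powR; rewrite ?nnegrE ?(ltW q0) ?powR_ge0.
rewrite powRM ?invr_ge0 ?(ltW c00)// ler_wpM2r ?powR_ge0// lerDl.
by rewrite divr_ge0 ?powR_ge0// ltW.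
Qed.

Lemma subregular_growth (kt al : R) : lsc_around f xbar -> asplund X ->
  0 < kt -> subregular_with_minorant f xbar xsbar q kt ->
  0 < al < q / (q * kt `^ q^-1) ->
  exists2 eta : R, 0 < eta & growth f xbar xsbar q al eta.
Proof.
move=> lscf asX kt0 [[ga1 ga10 msub] [ga2 [r [ga20 rc minor]]]] alc.
pose a := kt `^ q^-1; have a0 : 0 < a by rewrite powR_gt0.
set c := q / (q * kt `^ q^-1) in rc alc.
have cE : c = a^-1 by rewrite /c invfM mulrA divff ?mul1r// gt_eqF.
have c0 : 0 < c by rewrite cE invr_gt0.
have ktc : kt * c `^ q = 1.
  rewrite -[X in X * _](powRVK q0 (ltW kt0)) -powRM ?powR_ge0 ?(ltW c0)//.
  by rewrite cE mulfV ?powR1// gt_eqF.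
have /nbhs_ballP[rho0 /= rho00 rhoP] := lscf.
pose rho := Order.min (rho0 / 2) (Order.min ga1 ga2).
have rho_gt0 : 0 < rho by rewrite !lt_min ga10 ga20 divr_gt0.
have [r0 r1 r2] : [/\ rho < rho0, rho <= ga1 & rho <= ga2].
  split; rewrite ?ge_min ?lexx ?orbT//.
  by rewrite (@le_lt_trans _ _ (rho0 / 2)) ?ge_min ?lexx// ltr_pdivrMr// ltr_pMr// ltr1n.
pose A : set X := [set x | dom f x /\ `|x - xbar| <= rho].
pose g x : R := fine (f x) + - affine x.
have gA : epi_closed A g.
  apply: epi_closedD; last first.
    apply: lsc_epi_closed r0 _ => // x xr; apply: rhoP.
    by rewrite -ball_normE/= distrC.
  apply: (@lip_continuous _ _ `|xsbar|) => x y.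
  rewrite /affine (_ : _ - _ = (xsbar (y - x) : R)).
    by rewrite (distrC x); exact: dual_norm_ub.
  by rewrite !dual_sub; ring.
have glb x : A x -> - (r * theta q (m x)) <= g x.
  move=> [fx xr]; have : ((affine x - r * theta q (m x))%:E <= f x)%E.
    rewrite -minorant_boundE; apply: minor.
    by apply/closed_ball_le => //; exact: le_trans r2.
  by rewrite (fineE f_proper fx) lee_fin /g lerBrDr addrC.
(* A subgradient of [g] of norm at most [L'] at some [z] near [y], shifted by [xsbar], is a regular
   subgradient of [f]; subregularity then bounds [m z]. *)
have slope y L L' : A y -> `|y - xbar| < rho -> 0 < L -> L < L' ->
    (exists2 tau, 0 < tau & forall x, A x -> `|x - y| <= tau ->
       g y - L * `|x - y| <= g x) -> m y <= kt * L' `^ q.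
  move=> Ay yrho L0 LL' [tau tau0 taug].
  apply/ler_addgt0Pr => e e0.
  (* The three terms keep the norm below [L'], the change of [m] below [e], and [z] in the open ball
     of radius [rho], where [A] is locally just [dom f]. *)
  pose e' := Order.min (L' - L) (Order.min e (rho - `|y - xbar|)).
  have e'0 : 0 < e' by rewrite !lt_min e0 !subr_gt0 LL' yrho.
  have [eL ee er] : [/\ e' <= L' - L, e' <= e & e' <= rho - `|y - xbar|].
    by rewrite !ge_min !lexx !orbT.
  have [z [v [zy vL [Az fv]]]] :=
    asplund_subgradient asX gA Ay (ltW L0) tau0 taug e'0.
  have zrho : `|z - xbar| < rho.
    have := ler_normD (z - y) (y - xbar); rewrite subrKA.
    by move: zy er; move: (`|z - y|) (`|y - xbar|) (`|_|)=> *; lra.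
  have zsub : subdiff f z (v + xsbar).
    apply: regular_subdiff_subdiff; apply: regular_subdiff_intro => //.
      exact: Az.1.
    move=> s s0; have [d d0 dP] := fv s s0.
    exists (Order.min d (rho - `|z - xbar|)); first by rewrite lt_min d0 subr_gt0.
    move=> w; rewrite lt_min => /andP[wd wr].
    have [fw|fw] := ltP (f w) +oo%E; last by rewrite (le_trans _ fw)// leey.
    have Aw : A w.
      split=> //; have := ler_normD (w - z) (z - xbar); rewrite subrKA.
      by move: wr; move: (`|w - z|) (`|z - xbar|) (`|_|)=> *; lra.
    rewrite (fineE f_proper fw) lee_fin; have := dP w Aw wd.
    rewrite /g /affine [(v + xsbar) _](_ : _ = (v (w - z) : R) + xsbar (w - z))//.
    have : (xsbar (w - z) : R) = (xsbar (w - xbar) : R) - xsbar (z - xbar).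
      by rewrite !dual_sub; ring.
    move: (xsbar (w - z) : R) (xsbar (w - xbar) : R) (xsbar (z - xbar) : R).
    by move: (v _ : R) (s * _) (fine _) (fine _) (fine _)=> *; lra.
  have mz : m z <= kt * L' `^ q.
    have := msub z; rewrite -/S dist_set_real// -/(m z) -lee_fin => h.
    apply: (le_trans (h _)).
      by apply/closed_ball_le => //; exact: le_trans (ltW zrho) r1.
    rewrite EFinM lee_wpmul2l ?lee_fin ?(ltW kt0)//.
    apply: (le_trans (poweR_dist_le xsbar q0 zsub)); rewrite lee_fin.
    rewrite opprD addrCA subrr addr0 normrN.
    have vL' : `|v| <= L'.
      apply: (@le_trans _ _ (L + e')); last by rewrite -lerBrDl.
      by apply: dual_norm_le => //; rewrite addr_ge0 ?ltW.
    by apply: ge0_ler_powR; rewrite ?nnegrE ?(ltW q0) ?(le_trans _ vL').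
  have := rdist_lip S0 y z; rewrite mul1r ler_norml => /andP[_].
  rewrite distrC -/(m y) -/(m z); move: mz zy ee.
  by move: (`|_|) (_ * _) (m y) (m z)=> *; lra.
have [eta eta0 etaP] := growth_of_slope q0 gA rho_gt0 m0 (rdist_lip S0) mx glb
  slope kt0 c0 ktc rc alc.
exists (Order.min eta rho); first by rewrite lt_min eta0.
move=> x /closed_ball_le; rewrite lt_min eta0 rho_gt0 le_min => /(_ isT)/andP[xe xr].
have [fx|fx] := ltP (f x) +oo%E; last by rewrite (le_trans _ fx)// leey.
rewrite growth_boundE (fineE f_proper fx) lee_fin.
have := etaP x (conj fx xr) xe; rewrite /g.
by move: (affine x) (_ * _) (fine _)=> *; lra.
Qed.

End SubregularityGrowth.

Theorem theorem3p4 (R : realType) (X : completeNormedModType R)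
    (f : X -> \bar R) (xbar : X) (xsbar : dual X) (q : R)
    (hf : forall x, f x != -oo%E)
    (hlsc : lsc_around f xbar)
    (hdom : dom f xbar)
    (hsub : subdiff f xbar xsbar)
    (hq : 0 < q) :
  (forall alpha eta : R, 0 < alpha -> 0 < eta ->
     growth f xbar xsbar q alpha eta ->
     (exists2 beta : R, 0 < beta < alpha &
        local_subgradient_estimate f xbar xsbar q eta beta) ->
     exists2 ktilde : R, 0 < ktilde &
       subregular_with_minorant f xbar xsbar q ktilde)
  /\
  (asplund X ->
     forall ktilde : R, 0 < ktilde ->
       subregular_with_minorant f xbar xsbar q ktilde ->
       forall alpha : R, 0 < alpha < q / (q * ktilde `^ q^-1) ->
         exists2 eta : R, 0 < eta & growth f xbar xsbar q alpha eta).
Proof.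
split=> [al eta _ eta0 gr [be be_al est]|asX kt kt0 sub al al_c].
  exact: (growth_subregular hf hdom hsub hq eta0 be_al gr est).
exact: (subregular_growth hf hdom hsub hq hlsc asX kt0 sub al_c).
Qed.
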